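(* Let $K=K_1\times\cdots\times K_n$, where each $K_j$ is a non-polar compact subset of $\mathbb R$. For $\alpha(i)=(\alpha_1,\dots,\alpha_n)$, let $c_j=0$ if $\alpha_j=0$ and $c_j=1$ if $\alpha_j>0$. Then $$\inf\{\|P\|_K:P\in\mathcal P(\alpha(i))\}\ \ge\ \prod_{j=1}^n2^{c_j}\prod_{j=1}^n\mathrm{Cap}(K_j)^{\alpha_j},$$ and in particular $W_{\infty,\alpha(i)}(K,1)\ge2$ for all $i\ge1$. Equality holds for a given $\alpha(i)$ if and only if, for each $j$, either $\alpha_j=0$, or $K_j=R_{\alpha_j}^{-1}([-1,1])$ for some polynomial $R_{\alpha_j}$ of degree $\alpha_j$.
   Context: Monomials $z^\alpha=z_1^{\alpha_1}\cdots z_n^{\alpha_n}$, $\alpha\in\mathbb N_0^n$, are enumerated as $e_0=1,e_1,e_2,\dots$ with $e_i=z^{\alpha(i)}$. The enumeration is such that $|\alpha(i)|=\alpha_1+\dots+\alpha_n$ is non-decreasing in $i$. Among multi-indices of equal length it is ordered lexicographically: for $|\alpha|=|\beta|$, $\beta\prec\alpha$ iff for some $l$ one has $\alpha_l<\beta_l$ and $\alpha_k=\beta_k$ for all $k<l$. $\mathcal P(\alpha(i))$ denotes the set of polynomials of the form $e_i+\sum_{j<i}c_je_j$ with $c_j\in\mathbb C$. For compact $K\subset\mathbb C^n$, $\|\cdot\|_K$ denotes the sup norm on $K$. Set $t_i(K)=\inf\{\|P\|_K:P\in\mathcal P(\alpha(i))\}$ and $\tau^-(K)=\liminf_{i\to\infty}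 t_i(K)^{1/|\alpha(i)|}$. $W_{\infty,\alpha(i)}(K,1)=t_i(K)/[\tau^-(K)]^{|\alpha(i)|}$. $\mathrm{Cap}$ is logarithmic capacity. *)

(* Defs.v *)
From HB Require Import structures.
From mathcomp Require Import all_boot all_order all_algebra.
From mathcomp Require Import all_classical all_reals all_analysis.
From mathcomp Require Import complex.
Import Order.TTheory GRing.Theory Num.Theory.
Import numFieldNormedType.Exports.

Set Implicit Arguments.
Unset Strict Implicit.
Unset Printing Implicit Defensive.

Local Open Scope ring_scope.
Local Open Scope classical_set_scope.

Definition mdeg (n : nat) (a : 'I_n -> nat) : nat := (\sum_(j < n) a j)%N.

Definition lex_prec (n : nat) (b a : 'I_n -> nat) : Prop :=
  exists l : 'I_n, (a l < b l)%N /\ forall k : 'I_n, (k < l)%N -> a k = b k.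

Definition grlex_prec (n : nat) (b a : 'I_n -> nat) : Prop :=
  (mdeg b < mdeg a)%N \/ (mdeg b = mdeg a /\ lex_prec b a).

(* [e] is the enumeration i |-> alpha(i) of all multi-indices of N_0^n:
   it is onto and strictly increasing for the order above (hence a bijection
   nat -> N_0^n, with |alpha(i)| non-decreasing). *)
Definition monomial_enum (n : nat) (e : nat -> 'I_n -> nat) : Prop :=
  (forall a : 'I_n -> nat, exists i, e i = a) /\
  (forall i j : nat, (i < j)%N -> grlex_prec (e i) (e j)).

Definition monom (R : rcfType) (n : nat) (a : 'I_n -> nat) (x : 'I_n -> R) : R[i] :=
  \prod_(j < n) (((x j)%:C)%C ^+ a j).

Definition Pval (R : rcfType) (n : nat) (e : nat -> 'I_n -> nat) (i : nat)
  (c : nat -> R[i]) (x : 'I_n -> R) : R[i] :=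
  monom (e i) x + \sum_(j < i) c j * monom (e j) x.

Definition supnorm (R : realType) (n : nat) (K : set ('I_n -> R))
  (f : ('I_n -> R) -> R[i]) : R :=
  sup [set ComplexField.Normc.normc (f x) | x in K].

Definition tcheb (R : realType) (n : nat) (e : nat -> 'I_n -> nat)
  (K : set ('I_n -> R)) (i : nat) : R :=
  inf [set supnorm K (Pval e i c) | c in [set: nat -> R[i]]].

Definition tau_minus (R : realType) (n : nat) (e : nat -> 'I_n -> nat)
  (K : set ('I_n -> R)) : R :=
  limn_inf (fun i => powR (tcheb e K i) ((mdeg (e i))%:R^-1)).

Definition Wcheb (R : realType) (n : nat) (e : nat -> 'I_n -> nat)
  (K : set ('I_n -> R)) (i : nat) : R :=
  tcheb e K i / (tau_minus e K) ^+ mdeg (e i).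

Definition prodset (R : realType) (n : nat) (Kj : 'I_n -> set R) : set ('I_n -> R) :=
  [set x | forall j, Kj j (x j)].

(* logarithmic energy  I(mu) = \int\int log (1/|x-y|) dmu(x) dmu(y)  (log 1/0 = +oo) *)
Definition log_energy (R : realType) (mu : probability R R) : \bar R :=
  (\int[mu]_x \int[mu]_y
     (if x == y then +oo else (- ln `|x - y|)%:E))%E.

Definition robin_const (R : realType) (K : set R) : \bar R :=
  ereal_inf [set log_energy mu | mu in [set mu : probability R R | mu (~` K) = 0%E]].

Definition Cap (R : realType) (K : set R) : R :=
  if robin_const K is r%:E then expR (- r) else 0.

Definition nonpolar (R : realType) (K : set R) : Prop :=
  exists mu : probability R R, mu (~` K) = 0%E /\ (log_energy mu < +oo)%E.

Definition poly_preimage_interval (R : rcfType) (S : set R) (m : nat) : Prop :=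
  exists p : {poly R[i]}, size p = m.+1 /\
    forall z : R[i],
      (complex.Im p.[z] = 0 /\ -1 <= complex.Re p.[z] <= 1) <-> (complex.Im z = 0 /\ S (complex.Re z)).

Definition cind (k : nat) : nat := if (0 < k)%N then 1%N else 0%N.

(* Main.v *)
(* Discretising an energy by a greedy choice of points and bounding the Vandermonde determinant
   of these points in the basis x^r f^q gives Cap(K)^deg f <= ||f||_K for monic f; applying this
   to the iterates of f |-> f^2 - M^2/2, M = ||f||_K, which have norm 2 (M/2)^(2^k), improves it
   to 2 Cap(K)^deg f <= ||f||_K.  In one variable, the points of K minimising the norm of the
   divided difference give an extremal discrete functional which vanishes on lower degrees.
   Every monomial preceding e_i has an exponent smaller than the corresponding one of e_i, so
   the tensor product of such functionals annihilates it: the product-set problem splits into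
   one-variable problems.  Leja points give Fekete-Szego, hence tau^-(K) = min_j Cap(K_j) and
   the bound on W.
   In the equality case the iterates of the extremal f are extremal as well, which excludes
   quadratic factors positive on K, i.e. nonreal roots or two roots in one gap of K; but the
   preimages under f of the zeros of the Chebyshev iterates are dense in f^-1([-M, M]).
   Conversely, if K = p^-1([-1, 1]) with deg p = k, multiplying a monic g over the roots of
   p - w gives, up to a constant, a polynomial in w on [-1, 1], and root squaring shows that
   Cap(K)^k >= 1 / (2 |lead p|). *)

Require Import Defs.
From HB Require Import structures.
From mathcomp Require Import all_boot all_order all_algebra.
From mathcomp Require Import all_classical all_reals all_analysis.
From mathcomp Require Import measurable_realfun perm complex.
From mathcomp Require Import ring lra.
Import Order.TTheory GRing.Theory Num.Theory.
Import numFieldNormedType.Exports.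
Set Implicit Arguments.
Unset Strict Implicit.
Unset Printing Implicit Defensive.

Local Open Scope ring_scope.
Local Open Scope classical_set_scope.

(** * Energies and monic polynomials *)

(** Capacity enters only as an infimum of energies; no equilibrium measure or potential is used. An
    upper bound on [Cap K] must therefore hold for every measure of finite energy, which the
    Vandermonde argument allows, while a lower bound needs one explicit measure, constructed once,
    for Fekete-Szego. Several sharp inequalities are reached through crude ones whose constant does
    not depend on a growing power: the factor 2 in front of (M/2)^(2^k) disappears under the 2^k-th
    root, and so does the crude constant in the root-squaring argument. The competing polynomials
    have complex coefficients, but the dual functionals are real combinations of point values and
    the extremal polynomials are real, so the one-variable extremal problem is treated over the
    reals. Complex points return in the equality case, because [poly_preimage_interval] speaks of
    all complex z: the whole preimage must be shown to be real and contained in K_j. *)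

Lemma vandermonde_le (R : realDomainType) (N : nat) (x : 'I_N -> R)
    (Q : 'I_N -> {poly R}) (b : 'I_N -> R) :
  (forall a, Q a \is monic) -> (forall a, size (Q a) = a.+1) ->
  (forall a j, `|(Q a).[x j]| <= b a) ->
  \prod_(i < N) \prod_(j < N | (i < j)%N) `|x j - x i| <= N`!%:R * \prod_a b a.
Proof.
move=> Qm Qs Qb.
pose V := Vandermonde N (\row_j x j).
pose C : 'M[R]_N := \matrix_(a, c) (Q a)`_c.
(* The change from powers of x to the monic basis [Q] is unitriangular, so it preserves the
   Vandermonde determinant, whose N! terms are then bounded one by one. *)
have detC : \det C = 1.
  rewrite det_trig; last first.
    by apply/is_trig_mxP => i j ij; rewrite mxE nth_default// Qs.
  by apply: big1 => i _; rewrite mxE; have /eqP := Qm i; rewrite /lead_coef Qs.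
have CV : C *m V = \matrix_(a, j) (Q a).[x j].
  apply/matrixP => a j; rewrite !mxE.
  rewrite (horner_coef_wide (n := N)) ?Qs ?ltn_ord//.
  by apply: eq_bigr => c _; rewrite !mxE.
have -> : (\prod_(i < N) \prod_(j < N | (i < j)%N) `|x j - x i|) = `|\det (C *m V)|.
  rewrite det_mulmx detC mul1r /V det_Vandermonde normr_prod.
  apply: eq_bigr => i _; rewrite normr_prod.
  by apply: eq_bigr => j _; rewrite !mxE.
rewrite CV /determinant (le_trans (ler_norm_sum _ _ _))//.
have -> : N`!%:R * \prod_a b a = \sum_(s : 'S_N) \prod_a b a.
  by rewrite sumr_const card_Sn mulr_natl.
apply: ler_sum => s _; rewrite normrM normrX normrN1 expr1n mul1r normr_prod.
by apply: ler_prod => a _; rewrite normr_ge0 mxE Qb.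
Qed.

(** * Integration against a probability measure *)

Section prob.
Local Open Scope ereal_scope.
Context d {T : measurableType d} {R : realType}.
Variable mu : probability T R.

Lemma prob_integral_cst (v : \bar R) : \int[mu]_x v = v.
Proof.
by rewrite [LHS](integral_cst mu measurableT v) [X in _ * X]probability_setT mule1.
Qed.

(** The integral of [g] may be infinite. With f = g - b one has f^+ + b = g + f^-, where the
    integral of f^- is at most b, hence finite, and can be moved across. *)
Lemma prob_integral_subcst (g : T -> \bar R) (b : R) :
  (0 <= b)%R -> measurable_fun setT g -> (forall x, 0 <= g x) ->
  \int[mu]_x (g x - b%:E) = \int[mu]_x g x - b%:E.
Proof.
move=> b0 mg g0.
have mf : measurable_fun setT (fun x => g x - b%:E).
  by apply: emeasurable_funB => //; exact: measurable_cst.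
rewrite integralE.
set f := fun x => g x - b%:E.
have mfp : measurable_fun setT f^\+ by exact: measurable_funepos.
have mfn : measurable_fun setT f^\- by exact: measurable_funeneg.
have H : \int[mu]_x (f^\+ x) + b%:E = \int[mu]_x g x + \int[mu]_x (f^\- x).
  have -> : \int[mu]_x g x + \int[mu]_x (f^\- x) = \int[mu]_x (g x + f^\- x).
    by rewrite ge0_integralD.
  have -> : \int[mu]_x (f^\+ x) + b%:E = \int[mu]_x (f^\+ x + b%:E).
    by rewrite ge0_integralD// prob_integral_cst.
  apply: eq_integral => x _; rewrite /f funeposE funenegE.
  have := g0 x; case: (g x) => [r||]//= r0.
  - rewrite -?EFinD -!EFin_max -?EFinD; congr (_%:E).
    rewrite !maxEle; case: ifPn; case: ifPn => /=; lra.
  - by rewrite /maxe/= !(lt0y, ltNy0)//=.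
have fb : \int[mu]_x (f^\- x) <= b%:E.
  rewrite -[X in _ <= X](prob_integral_cst b%:E); apply: ge0_le_integral => //.
  move=> x _; rewrite funenegE /f; have := g0 x; case: (g x) => [r||]//= r0.
  - rewrite -?EFinD -EFin_max lee_fin ge_max b0 andbT; rewrite lee_fin in r0; lra.
  - by rewrite /maxe/= ?ltNy0 ?lee_fin.
have f0 : 0 <= \int[mu]_x (f^\- x) by exact: integral_ge0.
have f1 : 0 <= \int[mu]_x (f^\+ x) by exact: integral_ge0.
move: H fb f0 f1.
have : 0 <= \int[mu]_x g x by exact: integral_ge0.
move: (\int[mu]_x _) (\int[mu]_x f^\+ x) (\int[mu]_x f^\- x) => [u||] [v||] [w||] // _ + _ _ _.
rewrite -!EFinD => -[] H; congr (_%:E); lra.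
Qed.


Lemma measurable_integral_snd (f : T * T -> \bar R) : measurable_fun setT f ->
  measurable_fun setT (fun x => \int[mu]_y f (x, y)).
Proof.
move=> mf.
have -> : (fun x => \int[mu]_y f (x, y)) =
    (fun x => fubini_F mu f^\+ x - fubini_F mu f^\- x).
  apply/funext => x; rewrite integralE /fubini_F; congr (_ - _);
    by apply: eq_integral => y _; rewrite ?funeposE ?funenegE.
apply: emeasurable_funB; apply: measurable_fun_fubini_tonelli_F => //.
- exact: measurable_funepos.
- exact: measurable_funeneg.
Qed.

Lemma prob_exists_le (K : set T) (f : T -> \bar R) (v : \bar R) (eps : R) :
  measurable K -> mu (~` K) = 0 -> measurable_fun setT f ->
  (forall x, 0 <= f x) -> \int[mu]_x f x <= v -> v < +oo -> (0 < eps)%R ->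
  exists2 x, K x & f x <= v + eps%:E.
Proof.
move=> mK muK mf f0 fv voo eps0; apply: contrapT => H.
have v0 : 0 <= v by apply: le_trans fv; exact: integral_ge0.
have vfin : v \is a fin_num by rewrite ge0_fin_numE.
have : v + eps%:E <= \int[mu]_x f x.
  rewrite (@ge0_negligible_integral _ _ _ mu setT (~` K) f)//; last exact: measurableC.
  rewrite setTD setCK.
  have muK1 : mu K = 1.
    by have := probability_setC mu (measurableC mK); rewrite setCK muK sube0.
  rewrite -[X in X <= _]mule1 -muK1 -integral_cst//.
  apply: ge0_le_integral => //=.
  - by move=> x _; rewrite adde_ge0// lee_fin ltW.
  - exact: measurable_funTS.
  - move=> x Kx; rewrite leNgt; apply/negP => fx; apply: H.
    by exists x => //; exact: ltW.
move=> /le_trans/(_ fv); rewrite -(fineK vfin) -EFinD lee_fin.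
by rewrite gerDl leNgt eps0.
Qed.

Section greedy.
Variables (K : set T) (h : T * T -> \bar R).
Hypotheses (mK : measurable K) (muK : mu (~` K) = 0).
Hypotheses (mh : measurable_fun setT h) (h0 : forall z, 0 <= h z).
Let U x := \int[mu]_y h (x, y).
Let I := \int[mu]_x U x.
Hypothesis Ioo : I < +oo.

(* Conditional expectations: the points are chosen one by one, the energy of the [m] chosen
   points completed by [r] independent ones never exceeding its mean by more than [m]. *)
Lemma greedy_points (N : nat) : K !=set0 -> exists2 x : nat -> T, (forall i, K (x i)) &
  \sum_(j < N) \sum_(i < j) h (x i, x j) <= 'C(N, 2)%:R%:E * I + N%:R%:E.
Proof.
move=> [x0 Kx0].
have mU : measurable_fun setT U by exact: measurable_fun_fubini_tonelli_F.
have U0 x : 0 <= U x by exact: integral_ge0.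
have I0 : 0 <= I by exact: integral_ge0.
pose F (x : nat -> T) m r := \sum_(j < m) \sum_(i < j) h (x i, x j) +
   (r%:R%:E * (\sum_(i < m) U (x i)) + 'C(r, 2)%:R%:E * I).
suff H m r : (m + r)%N = N -> exists2 x : nat -> T, (forall i, K (x i)) &
    F x m r <= 'C(N, 2)%:R%:E * I + m%:R%:E.
  have [x Kx Fx] := H N 0%N (addn0 N); exists x => //.
  by move: Fx; rewrite /F !mul0e !adde0.
elim: m r => [|m IH] r mrN.
  exists (cst x0) => //; rewrite /F !big_ord0 mule0 !add0e adde0.
  by rewrite -mrN add0n.
have [x Kx Fx] := IH r.+1 (etrans (addnS _ _) mrN).
have mhr (y : T) : measurable_fun setT (fun z => h (y, z)).
  exact: measurableT_comp mh (measurable_pair1 _).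
pose A := \sum_(j < m) \sum_(i < j) h (x i, x j).
have A0 : 0 <= A by apply: sume_ge0 => j _; apply: sume_ge0.
pose B := \sum_(i < m) U (x i).
have B0 : 0 <= B by apply: sume_ge0.
(* [g z] is [F] at the next stage with z as the new point. As C(r + 1, 2) = C(r, 2) + r, its mean
   over z is [F x m r.+1], so some z in [K] exceeds this mean by at most 1. *)
pose g z := (A + 'C(r, 2)%:R%:E * I + r%:R%:E * B) +
   (\sum_(i < m) h (x i, z) + r%:R%:E * U z).
have mg1 : measurable_fun setT (fun z => \sum_(i < m) h (x i, z)).
  by apply: emeasurable_sum => i; exact: mhr.
have mg2 : measurable_fun setT (fun z => r%:R%:E * U z).
  exact: measurable_funeM.
have c0 : 0 <= A + 'C(r, 2)%:R%:E * I + r%:R%:E * B.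
  by rewrite !adde_ge0// mule_ge0.
have g10 z : 0 <= \sum_(i < m) h (x i, z) by exact: sume_ge0.
have mg : measurable_fun setT g.
  by apply: emeasurable_funD => //; exact: emeasurable_funD.
have intg : \int[mu]_z g z = F x m r.+1.
  rewrite /g ge0_integralD//; last 2 first.
  - by move=> z _; rewrite adde_ge0// mule_ge0.
  - exact: emeasurable_funD.
  rewrite prob_integral_cst ge0_integralD//; last by move=> z _; rewrite mule_ge0.
  rewrite ge0_integral_sum// ge0_integralZl_EFin// -/I /F -/A -/B.
  rewrite binS bin1 natrD -[r.+1%:R%R]natr1 !EFinD !ge0_muleDl ?lee_fin// mul1e.
  rewrite -[A + _ + _]addeA -addeA; congr (A + _).
  by rewrite (addeC (_ * I) (_ * B)) addeACA.
have [|||y Ky gy] := @prob_exists_le K g (F x m r.+1) 1 mK muK mg _ _ _ ltr01.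
- by move=> z; rewrite !adde_ge0// mule_ge0.
- by rewrite intg.
- apply: le_lt_trans Fx _.
  by rewrite lte_add_pinfty ?ltry// lte_mul_pinfty.
exists (fun i => if (i < m)%N then x i else y); first by move=> i; case: ifP.
have -> : F (fun i => if (i < m)%N then x i else y) m.+1 r = g y.
  rewrite /F /g !big_ord_recr/= ltnn.
  have -> : \sum_(i < m) \sum_(i0 < i) h ((if (i0 < m)%N then x i0 else y),
       (if (i < m)%N then x i else y)) = A.
    apply: eq_bigr => j _; apply: eq_bigr => i _.
    by rewrite ltn_ord (ltn_trans (ltn_ord i) (ltn_ord j)).
  have -> : \sum_(i < m) h (if (i < m)%N then x i else y, y) = \sum_(i < m) h (x i, y).
    by apply: eq_bigr => i _; rewrite ltn_ord.
  have -> : \sum_(i < m) U (if (i < m)%N then x i else y) = B.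
    by apply: eq_bigr => i _; rewrite ltn_ord.
  rewrite ge0_muleDr// -/A -/B -!addeA; congr (A + _).
  by rewrite addeA addeC -!addeA [RHS]addeCA; congr (_ + _); rewrite addeC -addeA addeCA addeC -!addeA.
rewrite (le_trans gy)// (le_trans (leeD2r _ Fx))//.
by rewrite -addeA -EFinD natr1.
Qed.

End greedy.

End prob.

(** * The logarithmic kernel made nonnegative *)

Section kernel.
Context {R : realType}.
Local Open Scope ereal_scope.

Definition log_kernel (z : R * R) : \bar R :=
  if z.1 == z.2 then +oo else (- ln `|z.1 - z.2|)%:E.

(** Nonnegative, as Tonelli and Fatou require. When [expR b] bounds the diameter of K, the cut at 0
    never acts on K x K. *)
Definition shifted_kernel (b : R) (z : R * R) : \bar R :=
  maxe 0 (log_kernel z + b%:E).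

Lemma measurable_log_kernel : measurable_fun setT log_kernel.
Proof.
apply: measurable_fun_ifT => //=.
- apply: (@measurable_fun_eqr _ _ R setT fst snd) => //; exact: measurable_funTS.
- apply/measurable_EFinP; apply: measurableT_comp => //.
  apply: measurableT_comp; first exact: measurable_ln.
  by apply: measurableT_comp => //; exact: measurable_funB.
Qed.

Lemma measurable_shifted_kernel (b : R) : measurable_fun setT (shifted_kernel b).
Proof.
apply: measurable_maxe => //; apply: emeasurable_funD => //.
exact: measurable_log_kernel.
Qed.

Lemma shifted_kernel_ge0 b z : 0 <= shifted_kernel b z.
Proof. by rewrite /shifted_kernel le_max lexx. Qed.

Lemma shifted_kernelE (b : R) (z : R * R) : (`|z.1 - z.2| <= expR b)%R ->
  shifted_kernel b z = log_kernel z + b%:E.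
Proof.
move=> zb; apply/max_idPr; rewrite /log_kernel; case: ifPn => [_|z12].
  by rewrite addye.
rewrite -EFinD lee_fin addrC subr_ge0 -{1}(expRK b) ler_ln ?posrE ?expR_gt0//.
by rewrite normr_gt0 subr_eq0.
Qed.

Lemma log_energy_shift (K : set R) (mu : probability R R) (b : R) :
  (0 <= b)%R -> closed K -> mu (~` K) = 0 ->
  (forall x y, K x -> K y -> (`|x - y| <= expR b)%R) ->
  log_energy mu = \int[mu]_x \int[mu]_y shifted_kernel b (x, y) - b%:E.
Proof.
move=> b0 cK muK Kb.
have mK : measurable K by exact: closed_measurable.
have aeK (f g : R -> \bar R) : (forall x, K x -> f x = g x) -> ae_eq mu setT f g.
  move=> fg; exists (~` K); split; [exact: measurableC|exact: muK|].
  by move=> x /= H Kx; apply: H => _; exact: fg.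
have mk := measurable_log_kernel.
have mk1 x : measurable_fun setT (fun y => log_kernel (x, y)).
  exact: measurableT_comp mk (measurable_pair1 _).
have mh1 x : measurable_fun setT (fun y => shifted_kernel b (x, y)).
  exact: measurableT_comp (measurable_shifted_kernel b) (measurable_pair1 _).
have mU : measurable_fun setT (fun x => \int[mu]_y log_kernel (x, y)).
  exact: measurable_integral_snd.
have mH : measurable_fun setT (fun x => \int[mu]_y shifted_kernel b (x, y)).
  by apply: measurable_integral_snd; exact: measurable_shifted_kernel.
rewrite -prob_integral_subcst//; last first.
  by move=> x; apply: integral_ge0 => y _; exact: shifted_kernel_ge0.
rewrite /log_energy -[LHS]/(\int[mu]_x \int[mu]_y log_kernel (x, y)).
apply: ae_eq_integral => //; first exact: emeasurable_funB.
apply: (aeK) => x Kx; rewrite -prob_integral_subcst//; last first.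
  by move=> y; exact: shifted_kernel_ge0.
apply: ae_eq_integral => //; first exact: emeasurable_funB.
apply: (aeK) => y Ky; rewrite shifted_kernelE; last exact: Kb.
by rewrite addeK.
Qed.

End kernel.

(** * Lower bounds on energies *)

Section capacity_upper.
Context {R : realType}.

Lemma compact_realP (K : set R) : compact K ->
  closed K /\ exists2 b : R, 0 <= b & (forall x, K x -> `|x| <= expR b) /\
    (forall x y, K x -> K y -> `|x - y| <= expR b).
Proof.
move=> cK; split; first exact: compact_closed cK.
have [M [Mr MK]] := compact_bounded cK.
pose B := `|M| + 1.
have KB x : K x -> `|x| <= B.
  by apply: MK; rewrite (le_lt_trans (ler_norm _))// ltrDl.
have B1 : 1 <= B by rewrite lerDr.
exists (ln (2 * B)).
  by rewrite ln_ge0//; lra.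
have -> : expR (ln (2 * B)) = 2 * B by rewrite lnK// posrE; lra.
split=> [x /KB|x y /KB ? /KB ?]; first lra.
by rewrite (le_trans (ler_normB _ _))//; lra.
Qed.

Lemma sum_shifted_kernel (b : R) (N : nat) (x : nat -> R) (v : R) :
  (forall i j, `|x i - x j| <= expR b) ->
  (\sum_(j < N) \sum_(i < j) shifted_kernel b (x i, x j) <= v%:E)%E ->
  (forall i j : nat, (i < j < N)%N -> x i != x j) /\
  \sum_(j < N) \sum_(i < j) (b - ln `|x i - x j|) <= v.
Proof.
move=> xb H.
have xx : forall i j : nat, (i < j < N)%N -> x i != x j.
  move=> i j /andP[ij jN]; apply/eqP => xij.
  move: H; rewrite (bigD1 (Ordinal jN))//= (bigD1 (Ordinal ij))//=.
  have k0 (p q : nat) : (0 <= shifted_kernel b (x p, x q))%E.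
    exact: shifted_kernel_ge0.
  move=> H; have : (shifted_kernel b (x i, x j) <= v%:E)%E.
    apply: le_trans H; apply: (le_trans _ (leeDl _ _)).
      by apply: leeDl; exact: sume_ge0.
    by apply: sume_ge0 => p _; exact: sume_ge0.
  by rewrite shifted_kernelE//= /log_kernel/= xij eqxx addye// leye_eq.
split => //; rewrite -lee_fin; apply: le_trans H.
rewrite -sumEFin; apply: lee_sum => j _; rewrite -sumEFin; apply: lee_sum => i _.
have xij : x i <> x j by apply/eqP; rewrite xx// !ltn_ord.
rewrite shifted_kernelE//= /log_kernel/=; case: ifPn => [/eqP//|_].
by rewrite -EFinD lee_fin addrC.
Qed.

(** The excess [N] over the mean is negligible against the C(N, 2) pairs. The points are distinct
    because the kernel is infinite on the diagonal. *)
Lemma energy_points (K : set R) (mu : probability R R) :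
  compact K -> mu (~` K) = 0%E -> (log_energy mu < +oo)%E ->
  exists2 I : R, log_energy mu = I%:E & forall N : nat,
  exists x : nat -> R, [/\ (forall i, K (x i)),
    (forall i j : nat, (i < j < N)%N -> x i != x j) &
    \sum_(j < N) \sum_(i < j) (- ln `|x i - x j|) <= 'C(N, 2)%:R * I + N%:R].
Proof.
move=> cK muK muoo; have [clK [b b0 [_ Kb]]] := compact_realP cK.
have mK : measurable K by exact: closed_measurable.
have E := log_energy_shift b0 clK muK Kb.
have h0 := @shifted_kernel_ge0 R b.
have J0 : (0 <= \int[mu]_x \int[mu]_y shifted_kernel b (x, y))%E.
  by apply: integral_ge0 => x _; apply: integral_ge0 => y _.
have [J EJ] : exists J : R, (\int[mu]_x \int[mu]_y shifted_kernel b (x, y) = J%:E)%E.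
  by move: E J0 muoo; case: (\int[mu]_x _)%E => [J||]//; [exists J|move=> ->].
exists (J - b); first by rewrite E EJ.
move=> N.
have K0 : K !=set0.
  apply/set0P/eqP => K0; have := @probability_setT _ _ _ mu.
  by move: muK; rewrite K0 setC0 => -> /eqP; rewrite eqe eq_sym oner_eq0.
have [|x Kx] := greedy_points mK muK (measurable_shifted_kernel b) h0 _ N K0.
  by rewrite EJ ltry.
rewrite EJ -EFinM -EFinD => /sum_shifted_kernel[|xx xN].
  by move=> i j; exact: Kb.
exists x; split=> //.
have -> : \sum_(j < N) \sum_(i < j) (- ln `|x i - x j|) =
   \sum_(j < N) \sum_(i < j) (b - ln `|x i - x j|) - 'C(N, 2)%:R * b.
  apply/eqP; rewrite -subr_eq opprK; apply/eqP.
  have -> : 'C(N, 2)%:R * b = \sum_(j < N) \sum_(i < j) b.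
    under eq_bigr do rewrite sumr_const card_ord -mulr_natl.
    rewrite -mulr_suml -natr_sum; congr (_%:R * _).
    by rewrite -bin2_sum big_mkord.
  rewrite -big_split/=; apply: eq_bigr => j _; rewrite -big_split/=.
  by apply: eq_bigr => i _; rewrite addrC.
by rewrite mulrBr -addrAC lerD2r.
Qed.

(** The total exponent of f in the basis polynomials x^(a mod D) f^(a div D), a < L D. *)
Lemma sum_divn (L D : nat) : (0 < D)%N -> (\sum_(a < L * D) a %/ D = D * 'C(L, 2))%N.
Proof.
move=> D0; rewrite -(big_mkord xpredT (fun a => a %/ D)%N).
elim: L => [|L IH]; first by rewrite mul0n big_geq// muln0.
rewrite mulSn addnC (big_cat_nat_idem _ (leq0n _) (leq_addr _ _)) ?addn0//= IH.
rewrite -{1}(add0n (L * D)%N) big_addn addKn big_mkord.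
rewrite (eq_bigr (fun=> L)); last first.
  by move=> i _; rewrite addnC divnMDl// divn_small ?addn0.
by rewrite sum_nat_const card_ord binS bin1 mulnDr addnC.
Qed.

Lemma fact_leX (N : nat) : (N`! <= N ^ N)%N.
Proof.
rewrite fact_prod big_add1 big_mkord/= -[X in (_ <= _ ^ X)%N](card_ord N) -prod_nat_const.
by apply: leq_prod.
Qed.

Lemma monic_basis (f : {poly R}) (D a : nat) : (0 < D)%N -> f \is monic -> size f = D.+1 ->
  ('X^(a %% D) * f ^+ (a %/ D) \is monic) /\ size ('X^(a %% D) * f ^+ (a %/ D)) = a.+1.
Proof.
move=> D0 fm fs; have fam : f ^+ (a %/ D) \is monic by exact: monic_exp.
split; first by rewrite monicMl ?monicXn.
rewrite size_Mmonic ?monic_neq0 ?monicXn// size_polyXn.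
have := size_exp f (a %/ D); rewrite fs /= => H.
have fn0 : size (f ^+ (a %/ D)) != 0%N by rewrite size_poly_eq0 monic_neq0.
by rewrite -[size (f ^+ _)]prednK ?lt0n// H addnS/= mulnC addnC -divn_eq.
Qed.

Lemma natr_bin2 (n : nat) : 'C(n, 2)%:R = n%:R * (n%:R - 1) / 2 :> R.
Proof.
elim: n => [|n IH]; first by rewrite !mul0r.
by rewrite binS bin1 natrD IH -natr1; field.
Qed.

(* Vandermonde determinant of [L * D] points in the monic basis of [monic_basis], [L] tending
   to infinity. *)
Lemma energy_le_of_monic (K : set R) (mu : probability R R) (f : {poly R}) (D : nat) (M : R) :
  compact K -> mu (~` K) = 0%E -> (log_energy mu < +oo)%E ->
  f \is monic -> size f = D.+1 -> (0 < D)%N -> (forall x, K x -> `|f.[x]| <= M) ->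
  exists2 I : R, log_energy mu = I%:E & expR (- I) ^+ D <= M.
Proof.
move=> cK muK muoo fm fs D0 fM.
have [_ [b b0 [Kb _]]] := compact_realP cK.
have [I EI HI] := energy_points cK muK muoo; exists I => //.
have M0 : 0 <= M.
  by have [x [Kx _ _]] := HI 1%N; apply: le_trans (fM _ (Kx 0%N)).
have main (L : nat) : expR (- ('C(L * D, 2)%:R * I + (L * D)%:R)) <=
   (L * D)%:R ^+ (L * D) * expR b ^+ (D * (L * D)) * M ^+ (D * 'C(L, 2)).
  pose N := (L * D)%N; rewrite -/N.
  have [x [Kx xx xN]] := HI N.
  pose Q (a : 'I_N) : {poly R} := 'X^(a %% D) * f ^+ (a %/ D).
  have V := @vandermonde_le R N (fun i => x i) Q
    (fun a => expR b ^+ D * M ^+ (a %/ D)).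
  apply: le_trans (le_trans (V _ _ _) _).
  - have -> : \prod_(i < N) \prod_(j < N | (i < j)%N) `|x j - x i| =
       \prod_(j < N) \prod_(i < j) `|x i - x j|.
      rewrite (exchange_big_dep xpredT)//=; apply: eq_bigr => j _.
      rewrite (big_ord_widen_cond N xpredT (fun i => `|x i - x j|)); last exact: ltnW.
      by apply: eq_bigr => i _; rewrite distrC.
    have -> : \prod_(j < N) \prod_(i < j) `|x i - x j| =
        expR (\sum_(j < N) \sum_(i < j) ln `|x i - x j|).
      rewrite expR_sum; apply: eq_bigr => j _; rewrite expR_sum; apply: eq_bigr => i _.
      by rewrite lnK// posrE normr_gt0 subr_eq0 xx// !ltn_ord.
    rewrite ler_expR lerNl; apply: le_trans xN.
    by rewrite -sumrN; apply: ler_sum => j _; rewrite -sumrN.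
  - by move=> a; have [] := monic_basis a D0 fm fs.
  - by move=> a; have [] := monic_basis a D0 fm fs.
  - move=> a j; rewrite /Q hornerM !hornerXn horner_exp normrM !normrX.
    apply: ler_pM; rewrite ?exprn_ge0//; last by rewrite lerXn2r ?nnegrE// fM.
    apply: (@le_trans _ _ (expR b ^+ (a %% D))).
      by rewrite lerXn2r ?nnegrE ?expR_ge0// Kb.
    apply: ler_weXn2l; first by rewrite -expR0 ler_expR.
    by apply: ltnW; rewrite ltn_pmod.
  - rewrite big_split/= prodr_const card_ord -exprM.
    have -> : \prod_(a < N) M ^+ (a %/ D) = M ^+ (D * 'C(L, 2)).
      by rewrite -sum_divn// expr_sum.
    rewrite mulrA ler_wpM2r ?exprn_ge0// ler_wpM2r ?exprn_ge0 ?expR_ge0//.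
    by rewrite -natrX ler_nat fact_leX.
(* At L = 2 the exponent D C(L, 2) of M is D > 0, so M = 0 would make the right-hand side of [main]
   vanish. *)
have {}M0 : 0 < M.
  rewrite lt_neqAle M0 andbT; apply/eqP => M00.
  have := main 2%N; rewrite -M00 binn muln1 expr0n (gtn_eqF D0) mulr0.
  by rewrite leNgt expR_gt0.
rewrite -ler_ln ?posrE ?exprn_gt0 ?expR_gt0// lnXn ?expR_gt0// expRK.
rewrite leNgt; apply/negP => lnMI.
pose d := (- I) *+ D - ln M.
have d0 : 0 < d by rewrite subr_gt0.
(* Taking logarithms in [main] and dividing by L D gives L d / 2 <= ln L + C. The choice L = s^2
   lets ln s <= s absorb ln L, and a division by s leaves a bound linear in s. *)
pose C := ln D%:R + D%:R * b + 1 - I / 2 - ln M / 2.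
have key (s : nat) : (0 < s)%N -> s%:R * (d / 2) <= 2 + `|C|.
  move=> s0; pose L := (s * s)%N.
  have LD0 : 0 < (L * D)%:R :> R by rewrite ltr0n !muln_gt0 s0.
  have := main L; rewrite -ler_ln ?posrE ?expR_gt0//; last first.
    by rewrite !mulr_gt0 ?exprn_gt0 ?expR_gt0.
  have LD1 : 0 < (L * D)%:R ^+ (L * D) :> R by rewrite exprn_gt0.
  have LD2 : 0 < expR b ^+ (D * (L * D)) by rewrite exprn_gt0// expR_gt0.
  have LD3 : 0 < M ^+ (D * 'C(L, 2)) by rewrite exprn_gt0.
  rewrite expRK lnM ?posrE// ?mulr_gt0// (lnM LD1 LD2) lnXn// lnXn ?expR_gt0// lnXn//.
  rewrite expRK -(mulr_natr (ln _) (L * D)) -(mulr_natr b) -(mulr_natr (ln M)).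
  rewrite !natrM !natr_bin2 natrM.
  have l0 : 0 < L%:R :> R by rewrite ltr0n muln_gt0 s0.
  have dR0 : 0 < D%:R :> R by rewrite ltr0n.
  have sR0 : 1 <= s%:R :> R by rewrite ler1n.
  have s1 : 0 < s%:R :> R by rewrite ltr0n.
  have -> : ln (s%:R * s%:R * D%:R : R) = ln s%:R + ln s%:R + ln D%:R.
    by rewrite !lnM ?posrE ?mulr_gt0.
  have lns : ln (s%:R : R) <= s%:R by apply/ltW/ln_sublinear; rewrite ltr0n.
  have -> : L%:R = s%:R * s%:R :> R by rewrite natrM.
  rewrite /d -(mulr_natr (- I) D) => H.
  have {}H : s%:R * s%:R * ((- I * D%:R - ln M) / 2) <=  2 * s%:R + C.
    have sD : 0 < s%:R * s%:R * D%:R :> R by rewrite !mulr_gt0// (lt_le_trans ltr01).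
    have P : (0 : R) <= s%:R * s%:R * D%:R * (s%:R - ln (s%:R : R)).
      by apply: mulr_ge0; [exact: ltW|rewrite subr_ge0].
    rewrite -(ler_pM2l sD) /C; move: H P; lra.
  have CC : C <= `|C| by exact: ler_norm.
  have C0 : 0 <= `|C| by [].
  rewrite -(ler_pM2l (lt_le_trans ltr01 sR0)); nra.
have [s sd] : exists s : nat, (2 + `|C|) / (d / 2) < s%:R.
  by exists (Num.truncn ((2 + `|C|) / (d / 2))).+1; exact: truncnS_gt.
have /key : (0 < s)%N.
  rewrite lt0n; apply/eqP => s0; move: sd; rewrite s0 ltNge divr_ge0 ?addr_ge0// ltW//.
  by rewrite divr_gt0.
by rewrite leNgt -ltr_pdivrMr ?divr_gt0// sd.
Qed.

End capacity_upper.

(** * One-variable duality *)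

Section duality.
Context {R : realType}.

Lemma continuous_prod (T : topologicalType) (I : Type) (r : seq I) (P : pred I)
    (F : I -> T -> R) :
  (forall i, continuous (F i)) -> continuous (fun x => \prod_(i <- r | P i) F i x).
Proof.
move=> cF; elim: r => [|i r IH].
  by under eq_fun do rewrite big_nil; move=> x; exact: cst_continuous.
under eq_fun do rewrite big_cons; case: (P i) => //.
by move=> x; apply: cvgM; [exact: cF|exact: IH].
Qed.

Lemma continuous_sum (T : topologicalType) (I : Type) (r : seq I) (P : pred I)
    (F : I -> T -> R) :
  (forall i, continuous (F i)) -> continuous (fun x => \sum_(i <- r | P i) F i x).
Proof.
move=> cF; elim: r => [|i r IH].
  by under eq_fun do rewrite big_nil; move=> x; exact: cst_continuous.
under eq_fun do rewrite big_cons; case: (P i) => //.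
by move=> x; apply: cvgD; [exact: cF|exact: IH].
Qed.

Lemma continuous_max_dist (T : topologicalType) (d : R) (f g : T -> R) :
  continuous f -> continuous g -> continuous (fun x => Num.max d `|f x - g x|).
Proof.
move=> cf cg x; apply: (@continuous_max _ _ (cst d) (fun x => `|f x - g x|)).
  exact: cst_continuous.
by apply: cvg_norm; apply: cvgB; [exact: cf|exact: cg].
Qed.

Definition node_prod (m : nat) (x : 'I_m.+1 -> R) (i : 'I_m.+1) : R :=
  \prod_(l | l != i) (x i - x l).

(** The total mass of the weights of the divided difference at [x], by [node_coef] below. *)
Definition node_sum (m : nat) (x : 'I_m.+1 -> R) : R :=
  \sum_i `|node_prod x i|^-1.

Lemma node_prod_neq0 m (x : 'I_m.+1 -> R) i : injective x -> node_prod x i != 0.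
Proof.
by move=> xI; apply/prodf_neq0 => l li; rewrite subr_eq0 (inj_eq xI) eq_sym.
Qed.

Lemma node_sum_gt0 m (x : 'I_m.+1 -> R) : injective x -> 0 < node_sum x.
Proof.
move=> xI; rewrite /node_sum big_ord_recl ltr_pwDl ?sumr_ge0// invr_gt0 normr_gt0.
exact: node_prod_neq0.
Qed.

(* Distances are truncated from below at a small [d] to get a continuous function; [d] is so
   small that its minimisers have separated nodes. *)
Lemma node_sum_min (K : set R) (m : nat) (x0 : 'I_m.+1 -> R) :
  compact K -> injective x0 -> (forall i, K (x0 i)) ->
  exists x : 'I_m.+1 -> R, [/\ injective x, (forall i, K (x i)) &
    forall y : 'I_m.+1 -> R, injective y -> (forall i, K (y i)) ->
      node_sum x <= node_sum y].
Proof.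
move=> cK x0I Kx0.
have [_ [b b0 [_ Kb]]] := compact_realP cK.
pose B := expR b; have B1 : 1 <= B by rewrite -expR0 ler_expR.
have B0 : 0 < B by exact: expR_gt0.
have S0 := node_sum_gt0 x0I.
(* If two nodes were closer than d, the term of one of them in [Sd] would be at least 1 / (d
   B^(m+1)), all other factors being at most B; this exceeds [node_sum x0], the factor 2 giving
   strictness. *)
pose d := Num.min 1 (2 * B ^+ m.+1 * node_sum x0)^-1.
have q0 : 0 < 2 * B ^+ m.+1 * node_sum x0 by rewrite !mulr_gt0 ?exprn_gt0.
have d0 : 0 < d by rewrite lt_min ltr01 invr_gt0.
have d1 : d <= 1 by rewrite ge_min lexx.
have dS : d * B ^+ m.+1 * node_sum x0 < 1.
  have : d <= (2 * B ^+ m.+1 * node_sum x0)^-1 by rewrite ge_min lexx orbT.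
  rewrite -(ler_pM2r q0) mulVf ?gt_eqF//; lra.
pose Sd (v : 'rV[R]_m.+1) : R := \sum_i (\prod_(l | l != i) Num.max d `|v ord0 i - v ord0 l|)^-1.
have mx0 (r : R) : 0 < Num.max d r by rewrite lt_max d0.
have pr0 (v : 'rV[R]_m.+1) i : 0 < \prod_(l | l != i) Num.max d `|v ord0 i - v ord0 l|.
  by apply: prodr_gt0.
have cSd : continuous Sd.
  have cV i : continuous (fun v : 'rV[R]_m.+1 =>
      \prod_(l | l != i) Num.max d `|v ord0 i - v ord0 l|).
    apply: continuous_prod => l.
    by apply: continuous_max_dist; exact: coord_continuous.
  apply: (@continuous_sum _ _ _ _ (fun i (v : 'rV[R]_m.+1) =>
      (\prod_(l | l != i) Num.max d `|v ord0 i - v ord0 l|)^-1)) => i v.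
  exact: (cvgV (lt0r_neq0 (pr0 v i)) (cV i v)).
pose A := [set v : 'rV[R]_m.+1 | forall i, K (v ord0 i)].
have cA : compact A by have := @rV_compact R m.+1 (fun=> K) (fun=> cK); exact.
have [|v vA vmin] := @compact_EVT_min _ R Sd A _ cA (continuous_subspaceT cSd).
  by exists (\row_i x0 i) => i; rewrite mxE.
have Sdle (y : 'I_m.+1 -> R) : injective y -> Sd (\row_i y i) <= node_sum y.
  move=> yI; apply: ler_sum => i _; rewrite lef_pV2 ?posrE ?normr_gt0 ?node_prod_neq0//.
  rewrite /node_prod normr_prod; apply: ler_prod => l li; rewrite normr_ge0/= !mxE.
  by rewrite le_max lexx orbT.
move/set_mem : vA => vA.
have vsep i l : l != i -> d <= `|v ord0 i - v ord0 l|.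
  move=> li; rewrite leNgt; apply/negP => vil.
  have : (d * B ^+ m.+1)^-1 <= node_sum x0.
    apply: (@le_trans _ _ (Sd v)); last first.
      apply: le_trans (Sdle _ x0I); apply: vmin; apply/mem_set => j; rewrite mxE; exact: Kx0.
    rewrite /Sd (bigD1 i)//= -[X in X <= _]addr0; apply: lerD; last first.
      by apply: sumr_ge0 => j _; rewrite invr_ge0 ltW.
    rewrite lef_pV2 ?posrE ?pr0 ?mulr_gt0 ?exprn_gt0//.
    rewrite (bigD1 l)//= max_l ?(ltW vil)// ler_pM2l//.
    apply: (@le_trans _ _ (\prod_(j < m.+1 | (j != i) && (j != l)) B)).
      apply: ler_prod => j _; rewrite ltW//= ge_max (le_trans d1)//=.
      by apply: Kb; exact: vA.
    rewrite prodr_const; apply: ler_weXn2l => //.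
    by rewrite -[X in (_ <= X)%N](card_ord m.+1) max_card.
  rewrite -(ler_pM2l (x := d * B ^+ m.+1)) ?mulr_gt0 ?exprn_gt0//.
  rewrite mulfV ?gt_eqF ?mulr_gt0 ?exprn_gt0//.
  by rewrite leNgt dS.
have vI : injective (fun i => v ord0 i).
  move=> i l vil; apply/eqP; apply: contraT => il.
  have := vsep l i il; rewrite vil subrr normr0 leNgt d0//.
exists (fun i => v ord0 i); split=> // y yI Ky.
have -> : node_sum (fun i => v ord0 i) = Sd v.
  apply: eq_bigr => i _; rewrite /node_prod normr_prod; congr (_^-1).
  by apply: eq_bigr => l li; rewrite max_r// vsep.
by apply: le_trans (Sdle _ yI); apply: vmin; apply/mem_set => j; rewrite mxE; exact: Ky.
Qed.

Definition node_poly (m : nat) (x : 'I_m.+1 -> R) (i : 'I_m.+1) : {poly R} :=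
  (node_prod x i)^-1 *: \prod_(l | l != i) ('X - (x l)%:P).

Section nodes.
Variables (m : nat) (x : 'I_m.+1 -> R).
Hypothesis xI : injective x.

Lemma node_poly_val i j : (node_poly x i).[x j] = (i == j)%:R.
Proof.
rewrite hornerZ horner_prod; case: eqVneq => [<-|ij].
  under eq_bigr do rewrite hornerXsubC.
  by rewrite mulVf// node_prod_neq0.
by rewrite (bigD1 j) 1?eq_sym//= hornerXsubC subrr mul0r mulr0.
Qed.

Lemma size_node_poly i : size (node_poly x i) = m.+1.
Proof.
rewrite size_scale ?invr_eq0 ?node_prod_neq0//.
have -> : \prod_(l | l != i) ('X - (x l)%:P) = \prod_(l <- enum (predC1 i)) ('X - (x l)%:P).
  by rewrite big_enum.
by rewrite size_prod_XsubC -cardE cardC1 card_ord.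
Qed.

Lemma coef_node_poly i : (node_poly x i)`_m = (node_prod x i)^-1.
Proof.
have := size_node_poly i; rewrite coefZ size_scale ?invr_eq0 ?node_prod_neq0// => s.
have /eqP := monic_prod_XsubC (index_enum _) (fun l => l != i) x.
by rewrite /lead_coef s /= => ->; rewrite mulr1.
Qed.

Lemma node_poly_interp (g : {poly R}) : (size g <= m.+1)%N ->
  g = \sum_i g.[x i] *: node_poly x i.
Proof.
move=> gs; apply/eqP; rewrite -subr_eq0; apply/eqP.
apply: (@roots_geq_poly_eq0 _ _ [seq x i | i <- enum 'I_m.+1]).
- apply/allP => _ /mapP[j _ ->]; rewrite /root hornerD hornerN horner_sum.
  rewrite (bigD1 j)//= hornerZ node_poly_val eqxx mulr1 big1 ?addr0 ?subrr// => i ij.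
  by rewrite hornerZ node_poly_val (negbTE ij) mulr0.
- by rewrite map_inj_uniq ?enum_uniq.
- rewrite size_map size_enum_ord; apply: leq_trans (size_polyD _ _) _.
  rewrite geq_max gs size_polyN; apply: leq_trans (size_sum _ _ _) _.
  by apply/bigmax_leqP => i _; rewrite (leq_trans (size_scale_leq _ _))// size_node_poly.
Qed.

(** Lagrange interpolation read at the coefficient of degree m, which is the divided difference. *)
Lemma node_coef (g : {poly R}) : (size g <= m.+1)%N ->
  g`_m = \sum_i (node_prod x i)^-1 * g.[x i].
Proof.
move=> gs; rewrite {1}(node_poly_interp gs) coef_sum; apply: eq_bigr => i _.
by rewrite coefZ coef_node_poly mulrC.
Qed.

End nodes.

(* The functional is [T] times the divided difference at nodes minimising [node_sum], and [f]
   interpolates [T] times its signs.  If [`|f.[y]| > T], exchanging a suitable node for [y]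
   (simplex method) would decrease [node_sum]. *)
Lemma chebyshev_duality (K : set R) (m : nat) (x0 : 'I_m.+1 -> R) :
  compact K -> injective x0 -> (forall i, K (x0 i)) ->
  exists (x w : 'I_m.+1 -> R) (T : R) (f : {poly R}),
    [/\ 0 < T, forall i, K (x i), forall i, w i != 0, \sum_i `|w i| = 1 &
     [/\ forall g : {poly R}, (size g <= m.+1)%N -> \sum_i w i * g.[x i] = T * g`_m,
       f \is monic, size f = m.+1 & forall y, K y -> `|f.[y]| <= T]].
Proof.
move=> cK x0I Kx0; have [x [xI Kx xmin]] := node_sum_min cK x0I Kx0.
pose P := node_prod x; have P0 i : P i != 0 by exact: node_prod_neq0.
have S0 := node_sum_gt0 xI.
have [T [T0 TS]] : exists T, 0 < T /\ T * node_sum x = 1.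
  by exists (node_sum x)^-1; rewrite invr_gt0 mulVf ?gt_eqF.
have PV i : (P i)^-1 = Num.sg (P i) * `|P i|^-1.
  by rewrite -{1}[(P i)^-1]mulr_sg_norm sgrV normfV.
have sg2 i : Num.sg (P i) * Num.sg (P i) = 1 by rewrite -expr2 sqr_sg P0.
have nsg i : `|Num.sg (P i)| = 1 by rewrite normr_sg P0.
pose w i := T / P i.
have w0 i : w i != 0 by rewrite mulf_neq0 ?invr_eq0// gt_eqF.
have lam (g : {poly R}) : (size g <= m.+1)%N -> \sum_i w i * g.[x i] = T * g`_m.
  move=> gs; rewrite (node_coef xI gs) mulr_sumr; apply: eq_bigr => i _.
  by rewrite mulrA.
have nw i : `|w i| = T * `|P i|^-1.
  by rewrite normrM normfV (gtr0_norm T0).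
pose f := \sum_i (Num.sg (P i) * T) *: node_poly x i.
have fx i : f.[x i] = Num.sg (P i) * T.
  rewrite horner_sum (bigD1 i)//= hornerZ node_poly_val// eqxx mulr1.
  by rewrite big1 ?addr0// => j ji; rewrite hornerZ node_poly_val// (negbTE ji) mulr0.
have fs : (size f <= m.+1)%N.
  apply: leq_trans (size_sum _ _ _) _; apply/bigmax_leqP => i _.
  by rewrite (leq_trans (size_scale_leq _ _))// size_node_poly.
have fm : f`_m = 1.
  rewrite (node_coef xI fs) -TS mulr_sumr; apply: eq_bigr => i _.
  by rewrite fx -/(P i) PV mulrACA sg2 mul1r mulrC.
have fsz : size f = m.+1.
  apply/eqP; rewrite eqn_leq fs ltnNge; apply/negP => /leq_sizeP/(_ m (leqnn _)) fm0.
  by move: fm; rewrite fm0 => /esym/eqP; rewrite oner_eq0.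
have fmon : f \is monic by apply/eqP; rewrite /lead_coef fsz.
exists x, w, T, f; split=> //.
  by under eq_bigr do rewrite nw; rewrite -mulr_sumr TS.
split=> // y Ky; rewrite leNgt; apply/negP => Tfy.
pose s := Num.sg f.[y].
have sf : s * f.[y] = `|f.[y]| by rewrite -normrEsg.
pose L i := s * (node_poly x i).[y].
have eta (g : {poly R}) : (size g <= m.+1)%N -> \sum_i L i * g.[x i] = s * g.[y].
  move=> gs; rewrite {2}(node_poly_interp xI gs) horner_sum mulr_sumr.
  by apply: eq_bigr => i _; rewrite hornerZ /L mulrC mulrCA.
(* Otherwise every term of s f(y) = sum_i L_i f(x_i) would be nonpositive, as f(x_i) has the sign of
   w_i. *)
have [i1 Li1] : exists i, 0 < L i * w i.
  apply: contrapT => H; have : s * f.[y] <= 0.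
    rewrite -eta//; apply: sumr_le0 => i _; rewrite leNgt; apply/negP => Li.
    apply: H; exists i; have -> : L i * w i = L i * f.[x i] * `|P i|^-1.
      by rewrite fx /w PV; ring.
    by rewrite mulr_gt0// invr_gt0 normr_gt0.
  by rewrite sf leNgt (lt_trans T0).
pose q i := w i / L i.
(* The ratio test of the simplex method: the least ratio [t] is the largest step for which no weight
   of w - t L changes sign, and the weight at [i0] becomes 0. *)
have [i0 Li0 qmin] := @arg_minP _ _ _ i1 (fun i => 0 < L i * w i) q Li1.
pose t := q i0.
have Ln0 i : 0 < L i * w i -> L i != 0 by apply: contraTneq => ->; rewrite mul0r ltxx.
have t0 : 0 < t.
  by rewrite /t /q -(pmulr_lgt0 _ (_ : 0 < L i0 ^+ 2)) ?exprn_even_gt0 ?Ln0// expr2 mulrA mulfVK ?Ln0// mulrC.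
pose w1 i := w i - t * L i.
have w1i0 : w1 i0 = 0 by rewrite /w1 /t /q mulfVK ?subrr ?Ln0.
have w1s i : w1 i * Num.sg (P i) = `|w1 i|.
  rewrite -[RHS]mulr1 -(nsg i) -normrM ger0_norm// /w1 mulrBl subr_ge0 -mulrA.
  have wsg : w i * Num.sg (P i) = T / `|P i| by rewrite /w PV -[RHS]mulr1 -(sg2 i); ring.
  have TP : 0 < T / `|P i| by rewrite divr_gt0// normr_gt0.
  have Lw : L i * w i = L i * Num.sg (P i) * (T / `|P i|) by rewrite /w PV; ring.
  have [Lwi|Lwi] := ltP 0 (L i * w i); last first.
    rewrite wsg; apply: (@le_trans _ _ 0); last exact: ltW.
    by rewrite pmulr_rle0// -(pmulr_lle0 _ TP) -Lw.
  have Lsg : 0 < L i * Num.sg (P i) by rewrite -(pmulr_lgt0 _ TP) -Lw.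
  rewrite -ler_pdivlMr//; apply: le_trans (qmin _ Lwi) _.
  have sg0 : Num.sg (P i) != 0 by rewrite sgr_eq0.
  have Li : L i != 0 by exact: Ln0.
  suff -> : q i = w i * Num.sg (P i) / (L i * Num.sg (P i)) by [].
  by rewrite /q; field; apply/andP.
pose x1 i := if i == i0 then y else x i.
have yx i : y <> x i.
  move=> yxi; move: Tfy; rewrite yxi fx normrM normr_sg P0 mul1r (gtr0_norm T0).
  by rewrite ltxx.
have x1I : injective x1.
  move=> i j; rewrite /x1; case: eqP => [->|_]; case: eqP => [->|_]//.
  - by move/yx.
  - by move/esym/yx.
  - exact: xI.
have lam1 (g : {poly R}) : (size g <= m.+1)%N ->
    \sum_(i | i != i0) w1 i * g.[x i] + t * s * g.[y] = T * g`_m.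
  move=> gs; rewrite -lam// -mulrA -eta// mulr_sumr.
  have -> : \sum_(i | i != i0) w1 i * g.[x i] = \sum_i w1 i * g.[x i].
    by rewrite [RHS](bigD1 i0)//= w1i0 mul0r add0r.
  by rewrite -big_split/=; apply: eq_bigr => i _; rewrite /w1; ring.
(* On [f] the new representation reads T = T sum |w1| + t |f(y)|, and |f(y)| > T. *)
have sum1 : \sum_(i | i != i0) `|w1 i| + t < 1.
  have := lam1 f fs; rewrite fm mulr1 -mulrA sf.
  have -> : \sum_(i | i != i0) w1 i * f.[x i] = T * \sum_(i | i != i0) `|w1 i|.
    by rewrite mulr_sumr; apply: eq_bigr => i _; rewrite fx -w1s; ring.
  move=> H; rewrite -(ltr_pM2l T0) mulr1 -[ltRHS]H mulrDr ltrD2l mulrC.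
  by rewrite ltr_pM2l.
have : node_sum x <= node_sum x1.
  by apply: xmin => // i; rewrite /x1; case: ifP.
rewrite leNgt => /negP; apply.
have s1 : `|s| = 1 by rewrite normr_sg; case: eqP Tfy => // ->; rewrite normr0 ltNge ltW.
rewrite -(ltr_pM2l T0) TS; apply: le_lt_trans sum1.
(* Tested on the Lagrange polynomials of [x1], the new weights must be T times those of the divided
   difference at [x1]. Hence T [node_sum x1] < 1 = T [node_sum x]. *)
have x1w i : T * (node_prod x1 i)^-1 = if i == i0 then t * s else w1 i.
  have gs : (size (node_poly x1 i) <= m.+1)%N by rewrite size_node_poly.
  have := lam1 _ gs; rewrite coef_node_poly// => <-.
  have -> : y = x1 i0 by rewrite /x1 eqxx.
  have -> : \sum_(j | j != i0) w1 j * (node_poly x1 i).[x j] =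
     \sum_(j | j != i0) w1 j * (node_poly x1 i).[x1 j].
    by apply: eq_bigr => j /negbTE ji; rewrite /x1 ji.
  rewrite node_poly_val//; case: eqVneq => [->|ii0].
    rewrite mulr1 big1 ?add0r// => j ji; rewrite node_poly_val//.
    by rewrite eq_sym (negbTE ji) mulr0.
  rewrite mulr0 addr0 (bigD1 i)//= node_poly_val// eqxx mulr1 big1 ?addr0// => j /andP[_ ji].
  by rewrite node_poly_val// eq_sym (negbTE ji) mulr0.
rewrite /node_sum mulr_sumr (bigD1 i0)//= addrC.
have E i : T / `|node_prod x1 i| = `|if i == i0 then t * s else w1 i|.
  by rewrite -x1w normrM normfV (gtr0_norm T0).
apply: lerD.
  by apply: ler_sum => i /negbTE ii0; rewrite E ii0.
by rewrite E eqxx normrM s1 mulr1 gtr0_norm.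
Qed.

End duality.

(** * Capacity and Chebyshev iterates *)

Section doubling.
Context {R : realType}.

Lemma bernoulli_le (t : R) (n : nat) : 0 <= t -> 1 + n%:R * t <= (1 + t) ^+ n.
Proof.
move=> t0; elim: n => [|n IH]; first by rewrite mul0r addr0.
rewrite exprS -natr1; apply: (@le_trans _ _ ((1 + t) * (1 + n%:R * t))).
  have H : 0 <= n%:R * t * t by rewrite !mulr_ge0.
  lra.
by rewrite ler_pM2l//; lra.
Qed.

Lemma le_of_expr2n_le (a b C : R) : 0 <= a -> 0 <= b ->
  (forall k, a ^+ (2 ^ k) <= C * b ^+ (2 ^ k)) -> a <= b.
Proof.
move=> a0 b0 H; rewrite leNgt; apply/negP => ba.
have {b0} [b00|b0] : b = 0 \/ 0 < b by move: b0; rewrite le_eqVlt => /orP[/eqP <-|]; [left|right].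
  have := H 0%N; rewrite expn0 !expr1 b00 mulr0 leNgt => /negP; apply.
  by rewrite -b00.
have t0 : 0 < a / b - 1 by rewrite subr_gt0 ltr_pdivlMr// mul1r.
have C0 (k : nat) : (a / b) ^+ (2 ^ k) <= C.
  by rewrite expr_div_n ler_pdivrMr ?exprn_gt0.
pose k := (Num.truncn (C / (a / b - 1))).+1.
have kC : C / (a / b - 1) < k%:R by exact: truncnS_gt.
have := C0 k; rewrite leNgt => /negP; apply.
apply: (@lt_le_trans _ _ (1 + (2 ^ k)%:R * (a / b - 1))); last first.
  by rewrite -[X in _ <= X ^+ _](subrKC 1) bernoulli_le// ltW.
rewrite ltr_pdivrMr// in kC; apply: (lt_le_trans kC).
apply: (@le_trans _ _ ((2 ^ k)%:R * (a / b - 1))); last by rewrite lerDr.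
by rewrite ler_pM2r// ler_nat ltnW// ltn_expl.
Qed.

(* [f = M cos t] becomes [2 (M/2)^(2^k) cos (2^k t)], see [cheb_double_cos]. *)
Fixpoint cheb_double (f : {poly R}) (M : R) (k : nat) : {poly R} :=
  if k is k'.+1 then
    cheb_double f M k' ^+ 2 - (2 * (M / 2) ^+ (2 ^ k))%:P else f.

Lemma cheb_double_monic f M D k : f \is monic -> size f = D.+1 -> (0 < D)%N ->
  cheb_double f M k \is monic /\ size (cheb_double f M k) = (D * 2 ^ k).+1.
Proof.
move=> fm fs D0; elim: k => [|k [gm gs]]; first by rewrite muln1.
have g2m : cheb_double f M k ^+ 2 \is monic by exact: monic_exp.
have g2s : size (cheb_double f M k ^+ 2) = (D * 2 ^ k.+1).+1.
  by rewrite expr2 size_Mmonic ?monic_neq0// gs expnS /= addnS /= [(2 * _)%N]mulnC mulnA muln2 addnn.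
have lt : (size (- (2 * (M / 2) ^+ (2 ^ k.+1))%:P) < size (cheb_double f M k ^+ 2))%N.
  rewrite size_polyN g2s (leq_ltn_trans (size_polyC_leq1 _))// ltnS muln_gt0 D0.
  by rewrite expn_gt0.
by rewrite /= size_polyDl//; split=> //; rewrite monicE lead_coefDl// -monicE.
Qed.

(** If |g| <= 2q then 0 <= g^2 <= 4q^2, so g^2 - 2q^2 lies between -2q^2 and 2q^2: subtracting half
    the maximum of the square recentres it. *)
Lemma cheb_double_le f M k x : `|f.[x]| <= M ->
  `|(cheb_double f M k).[x]| <= 2 * (M / 2) ^+ (2 ^ k).
Proof.
move=> fM; elim: k => [|k IH]; first by rewrite expn0 expr1 mulrC divfK.
have M0 : 0 <= M by apply: le_trans fM.
have q0 : 0 <= (M / 2) ^+ (2 ^ k) by rewrite exprn_ge0// divr_ge0.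
rewrite /= hornerD hornerN hornerC horner_exp expnS mulnC exprM.
move: q0 IH; set q := (M / 2) ^+ _; set g := _.[x] => q0.
by rewrite !ler_norml => /andP[g1 g2]; apply/andP; split; nra.
Qed.

Lemma cheb_double_cos f M k x t : f.[x] = M * cos t ->
  (cheb_double f M k).[x] = 2 * (M / 2) ^+ (2 ^ k) * cos (t *+ (2 ^ k)).
Proof.
move=> fM; elim: k => [|k IH].
  by rewrite expn0 expr1 mulr1n /= fM mulrCA divff ?mulr1.
rewrite /= hornerD hornerN hornerC horner_exp IH expnS mulnC exprM mulrnA cos_mulr2n.
by set q := (M / 2) ^+ _; set c := cos _; field.
Qed.

End doubling.

Section capacity.
Context {R : realType}.
Variable K : set R.
Hypotheses (cK : compact K) (npK : nonpolar K).

Lemma robin_constE : exists2 r : R, robin_const K = r%:E & Cap K = expR (- r).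
Proof.
suff [r E] : exists r : R, robin_const K = r%:E by exists r => //; rewrite /Cap E.
have [mu [muK muoo]] := npK.
have [I EI _] := energy_points cK muK muoo.
have up : (robin_const K <= I%:E)%E by apply: ereal_inf_lbound; exists mu.
have [_ [b b0 [Kb _]]] := compact_realP cK.
have lo : ((- b)%:E <= robin_const K)%E.
  apply: le_ereal_inf_tmp => _ [nu nuK <-].
  have [nuoo|] := ltP (log_energy nu) +oo%E; last by rewrite leye_eq => /eqP ->; rewrite leey.
  have [||||J -> ] := @energy_le_of_monic _ K nu 'X 1 (expR b) cK nuK nuoo.
  - exact: monicX.
  - by rewrite size_polyX.
  - by [].
  - by move=> x Kx; rewrite hornerX Kb.
  - by rewrite expr1 ler_expR lee_fin lerNl.
by move: up lo; case: (robin_const K) => [r||]//; exists r.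
Qed.

Lemma Cap_gt0 : 0 < Cap K.
Proof. by have [r _ ->] := robin_constE; exact: expR_gt0. Qed.

Lemma Cap_ge (mu : probability R R) (v : R) : mu (~` K) = 0%E ->
  (log_energy mu <= v%:E)%E -> expR (- v) <= Cap K.
Proof.
move=> muK muv; have [r rE ->] := robin_constE.
rewrite ler_expR lerN2 -lee_fin -rE; apply: le_trans muv.
by apply: ereal_inf_lbound; exists mu.
Qed.

Lemma Cap_le_monic (f : {poly R}) (D : nat) (M : R) : f \is monic ->
  size f = D.+1 -> (0 < D)%N -> (forall x, K x -> `|f.[x]| <= M) -> Cap K ^+ D <= M.
Proof.
move=> fm fs D0 fM; have [r rE ->] := robin_constE.
have DR : 0 < D%:R :> R by rewrite ltr0n.
have M0 : 0 < M.
  have [mu [muK muoo]] := npK.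
  have [I _] := energy_le_of_monic cK muK muoo fm fs D0 fM.
  by apply: lt_le_trans; rewrite exprn_gt0// expR_gt0.
suff H : - (ln M / D%:R) <= r.
  rewrite -expRM_natl -[leRHS]lnK ?posrE// ler_expR mulrN lerNl.
  by move: H; rewrite -mulNr ler_pdivrMr// [r * _]mulrC.
rewrite -lee_fin -rE; apply: le_ereal_inf_tmp => _ [nu nuK <-].
have [nuoo|] := ltP (log_energy nu) +oo%E; last by rewrite leye_eq => /eqP ->; rewrite leey.
have [I -> IM] := energy_le_of_monic cK nuK nuoo fm fs D0 fM.
rewrite lee_fin lerNl ler_pdivlMr//.
by rewrite -ler_expR lnK ?posrE// mulrC expRM_natl.
Qed.

Lemma Cap_le_half (f : {poly R}) (D : nat) (M : R) : f \is monic ->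
  size f = D.+1 -> (0 < D)%N -> (forall x, K x -> `|f.[x]| <= M) -> 2 * Cap K ^+ D <= M.
Proof.
move=> fm fs D0 fM; have C0 := Cap_gt0.
have M0 : 0 <= M by apply: le_trans (Cap_le_monic fm fs D0 fM); rewrite exprn_ge0 ?ltW.
suff : Cap K ^+ D <= M / 2 by rewrite ler_pdivlMr// mulrC.
apply: (@le_of_expr2n_le _ _ _ 2) => [||k]; [by rewrite exprn_ge0 ?ltW|by rewrite divr_ge0|].
have [gm gs] := cheb_double_monic M k fm fs D0.
rewrite -exprM; apply: Cap_le_monic gm gs _ _; first by rewrite muln_gt0 D0 expn_gt0.
by move=> x Kx; apply: cheb_double_le; exact: fM.
Qed.

(** Finite energy forces distinct greedy points, so K is infinite; this supplies the initial nodes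
    for the duality. *)
Lemma nonpolar_points (m : nat) : exists x : 'I_m.+1 -> R, injective x /\ forall i, K (x i).
Proof.
have [mu [muK muoo]] := npK.
have [I EI /(_ m.+1)[x [Kx xx _]]] := energy_points cK muK muoo.
exists (fun i => x i); split=> // i j xij; apply/val_inj/eqP.
by case: ltngtP => // H; [have := xx i j|have := xx j i];
  rewrite H !ltn_ord xij eqxx => /(_ isT).
Qed.

End capacity.

(** * The Fekete-Szego theorem *)

Section liminf.
Context {R : realType}.
Local Open Scope ereal_scope.

Lemma limn_einf_leP (u : (\bar R)^nat) (l : R) :
  (forall (e : R) (n : nat), (0 < e)%R -> exists2 m, (n <= m)%N & u m <= (l + e)%:E) ->
  limn_einf u <= l%:E.
Proof.
move=> H; rewrite limn_einf_lim (cvg_lim _ (@cvg_einfs_sup _ u))//.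
apply: ge_ereal_sup => _ [n _ <-]; apply/lee_addgt0Pr => e e0.
have [m nm um] := H e n e0; rewrite -EFinD; apply: le_trans um.
by apply: ereal_inf_lbound; exists m.
Qed.

Lemma limn_einf_geP (u : (\bar R)^nat) (x : \bar R) :
  (forall y : R, y%:E < x -> exists n0, forall n, (n0 <= n)%N -> y%:E <= u n) ->
  x <= limn_einf u.
Proof.
move=> H; rewrite limn_einf_lim (cvg_lim _ (@cvg_einfs_sup _ u))//.
have {}H y : y%:E < x -> y%:E <= ereal_sup (range (einfs u)).
  move=> /H[n0 Hn]; apply: (@le_trans _ _ (einfs u n0)).
    by apply: le_ereal_inf_tmp => _ [n /= n0n <-]; exact: Hn.
  by apply: ereal_sup_ubound; exists n0.
case: x H => [r H|H|_]; last by rewrite leNye.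
- apply/lee_subgt0Pr => e e0; apply: H; rewrite lte_fin ltrBlDr ltrDl.
  exact: e0.
- rewrite leye_eq; apply/eqP/eqyP => A A0; apply: H; exact: ltry.
Qed.

End liminf.

(** * Step functions on [0, 1] *)

Section step.
Context {R : realType}.

(** The floor of N t on [0, 1[; the clamp at N - 1 keeps the index valid from t = 1 on, so that the
    step functions are monotone on the whole line. *)
Definition grid_index (N : nat) (t : R) : nat := minn (Num.truncn (t * N%:R)) N.-1.

Lemma grid_index_homo (N : nat) : {homo grid_index N : s t / s <= t >-> (s <= t)%N}.
Proof.
move=> s t st; rewrite /grid_index leq_min geq_minr andbT geq_min; apply/orP; left.
by apply: le_truncn; rewrite ler_wpM2r.
Qed.

Lemma grid_index_lt (N : nat) (t : R) : (0 < N)%N -> (grid_index N t < N)%N.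
Proof. by case: N => // N _; rewrite /grid_index ltnS geq_minr. Qed.

Lemma grid_index_sum (N : nat) (G : nat -> R) (t : R) : (0 < N)%N ->
  G (grid_index N t) = \sum_(k < N) G k * \1_[set s | grid_index N s = k] t.
Proof.
move=> N0; rewrite (bigD1 (Ordinal (grid_index_lt t N0)))//= indicE mem_set//= mulr1.
rewrite big1 ?addr0// => k kt; rewrite indicE memNset ?mulr0//= => E.
by case/eqP: kt; apply: val_inj.
Qed.

Lemma measurable_grid_index (N k : nat) : measurable [set t : R | grid_index N t = k].
Proof.
apply: is_interval_measurable => s t /= sk tk u /andP[su ut].
apply/eqP; rewrite eqn_leq -{1}tk (grid_index_homo N ut).
by rewrite -sk (grid_index_homo N su).
Qed.

Lemma measurable_grid_fun (N : nat) (G : nat -> R) : (0 < N)%N ->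
  measurable_fun [set: R] (fun t : R => G (grid_index N t)).
Proof.
move=> N0; under eq_fun do rewrite (grid_index_sum _ _ N0).
apply: measurable_sum => k; apply: measurable_funM => //.
by apply: measurable_indic; exact: measurable_grid_index.
Qed.

Lemma integral_grid (N : nat) (G : nat -> R) : (0 < N)%N -> (forall k, 0 <= G k) ->
  (\int[uniform_prob (@ltr01 R)]_t (G (grid_index N t))%:E =
   (N%:R^-1 * \sum_(k < N) G k)%:E)%E.
Proof.
move=> N0 G0; have NR : 0 < N%:R :> R by rewrite ltr0n.
have mG : measurable_fun [set: R] (fun t : R => (G (grid_index N t))%:E).
  by apply/measurable_EFinP; exact: measurable_grid_fun.
rewrite integral_uniform//; last by move=> t; rewrite lee_fin.
(* The point 1, where the clamp acts, is dropped: on [0, 1[ the level sets are exactly the intervals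
   [k/N, (k+1)/N[. *)
rewrite subr0 invr1 mul1e -integral_itv_bndo_bndc; last exact: measurable_funTS.
under eq_integral do rewrite (grid_index_sum _ _ N0) -sumEFin.
rewrite ge0_integral_sum//; last 2 first.
- move=> k; apply/measurable_EFinP; apply: measurable_funTS; apply: measurable_funM => //.
  by apply: measurable_indic; exact: measurable_grid_index.
- by move=> k t _; rewrite lee_fin mulr_ge0.
rewrite mulr_sumr -sumEFin; apply: eq_bigr => k _.
under eq_integral do rewrite EFinM.
rewrite ge0_integralZl_EFin//; last first.
  by apply/measurable_EFinP; apply: measurable_indic; exact: measurable_grid_index.
rewrite integral_indic//; last exact: measurable_grid_index.
rewrite mulrC EFinM; congr (_ * _)%E.
have -> : [set s : R | grid_index N s = k] `&` `[0, 1[%classic =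
    `[k%:R / N%:R, k.+1%:R / N%:R[%classic.
  apply/seteqP; split=> s /=; rewrite !in_itv/= ler_pdivrMr// ltr_pdivlMr//.
    move=> [+ /andP[s0 s1]]; have sN0 : 0 <= s * N%:R by rewrite mulr_ge0.
    rewrite /grid_index (minn_idPl _); last first.
      by rewrite -ltnS prednK// truncn_lt_nat// gtr_pMl.
    by move=> <-; exact: truncn_itv.
  move=> /andP[ks sk]; have s0 : 0 <= s.
    by rewrite -(pmulr_lge0 _ NR); apply: le_trans ks.
  have s1 : s < 1.
    rewrite -(ltr_pM2r NR) mul1r; apply: lt_le_trans sk _.
    by rewrite ler_nat.
  rewrite s0 s1; split=> //; rewrite /grid_index (@truncn_def _ _ k) ?ks//.
  by apply/minn_idPl; rewrite -ltnS prednK.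
apply: (etrans (lebesgue_measure_itv `[(k%:R / N%:R : R), (k.+1%:R / N%:R)[%R)).
rewrite /= lte_fin ltr_pM2r ?invr_gt0// ltr_nat ltnSn -EFinB.
by rewrite -mulrBl -natrB// subSnn mul1r.
Qed.

End step.

(** * Discontinuities of monotone functions *)

Section jumps.
Context {R : realType}.
Variable q : R -> R.
Hypothesis q_homo : {homo q : s t / s <= t}.

(** For non-decreasing [q], the points of discontinuity. *)
Definition jumps : set R :=
  [set t | exists2 e, 0 < e & forall d, 0 < d -> q (t - d) + e <= q (t + d)].

(** Each jump t receives a rational between the left limit [sup A] and [sup A + e]. For jumps u < v
    the value of [q] at the midpoint separates their rationals. *)
Lemma countable_jumps : countable jumps.
Proof.
have H t : jumps t -> exists r : rat, forall d, 0 < d -> q (t - d) < ratr r < q (t + d).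
  move=> [e e0 te].
  have te2 d1 d2 : 0 < d1 -> 0 < d2 -> q (t - d1) + e <= q (t + d2).
    move=> d10 d20; have m0 : 0 < Num.min d1 d2 by rewrite lt_min d10.
    apply: (@le_trans _ _ (q (t - Num.min d1 d2) + e)).
      by rewrite lerD2r; apply: q_homo; rewrite lerD2l lerN2 ge_min lexx.
    apply: le_trans (te _ m0) _; apply: q_homo; rewrite lerD2l ge_min lexx.
    by rewrite orbT.
  pose A := [set q (t - d) | d in [set d | 0 < d]].
  have A0 : A !=set0 by exists (q (t - 1)); exists 1 => /=.
  have Aub : ubound A (q (t + 1) - e).
    by move=> _ [d /= d0 <-]; rewrite lerBrDr te2.
  have supe : sup A < sup A + e by rewrite ltrDl.
  have [r] := rat_in_itvoo supe.
  rewrite in_itv/= => /andP[r1 r2]; exists r => d d0; apply/andP; split.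
    apply: le_lt_trans r1; apply: ub_le_sup; first by exists (q (t + 1) - e).
    by exists d.
  apply: (lt_le_trans r2); rewrite -lerBrDr; apply: ge_sup => // _ [d' /= d'0 <-].
  by rewrite lerBrDr te2.
pose ch t : rat := if pselect (jumps t) is left h then projT1 (cid (H t h)) else 0.
have chP t : jumps t -> forall d, 0 < d -> q (t - d) < ratr (ch t) < q (t + d).
  by move=> tJ; rewrite /ch; case: pselect => // h; exact: (projT2 (cid (H t h))).
apply/countable_injP; exists (fun t => pickle (ch t)).
move=> s t /set_mem sJ /set_mem tJ /(pcan_inj pickleK) st.
suff W (u v : R) : jumps u -> jumps v -> ch u = ch v -> ~ u < v.
  by case: (ltgtP s t) => // [/(W _ _ sJ tJ st)|/(W _ _ tJ sJ (esym st))].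
move=> uJ vJ uv ltuv; pose d := (v - u) / 2.
have d0 : 0 < d by rewrite divr_gt0// subr_gt0.
have /andP[_ h1] := chP _ uJ _ d0; have /andP[h2 _] := chP _ vJ _ d0.
have := lt_trans h2 (eq_ind _ (fun r => ratr r < _) h1 _ uv).
have -> : u + d = v - d by rewrite /d; field.
by rewrite ltxx.
Qed.

Lemma not_jumps t e : ~ jumps t -> 0 < e -> exists2 d, 0 < d & q (t + d) < q (t - d) + e.
Proof.
move=> tJ e0; apply: contrapT => H; apply: tJ; exists e => // d d0.
by rewrite leNgt; apply/negP => lt; apply: H; exists d.
Qed.

End jumps.

(** * The truncated kernel *)

Section truncated_kernel.
Context {R : realType}.
Variable b : R.

(** For y >= 0 the superlevel sets are open strips around the diagonal. With [shifted_kernel_ge]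
    this expresses the lower semicontinuity needed in the passage to the limit. *)
Lemma shifted_kernel_gt (u v y : R) : (y%:E < shifted_kernel b (u, v))%E ->
  y < 0 \/ `|u - v| < expR (b - y).
Proof.
rewrite /shifted_kernel lt_max lte_fin => /orP[->|]; first by left.
rewrite /log_kernel/=; case: ifPn => [/eqP -> _|uv].
  by right; rewrite subrr normr0 expR_gt0.
rewrite -EFinD lte_fin => H; right.
by rewrite -ltr_ln ?posrE ?expR_gt0 ?normr_gt0 ?subr_eq0// expRK; lra.
Qed.

Lemma shifted_kernel_ge (u v y : R) : `|u - v| < expR (b - y) ->
  (y%:E <= shifted_kernel b (u, v))%E.
Proof.
rewrite /shifted_kernel le_max /log_kernel/= => H; apply/orP; right.
move: H; case: ifPn => [_ _|uv]; first by rewrite addye// leey.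
rewrite -ltr_ln ?posrE ?expR_gt0 ?normr_gt0 ?subr_eq0// expRK -EFinD lee_fin; lra.
Qed.

Lemma shifted_kernelC (u v : R) : shifted_kernel b (u, v) = shifted_kernel b (v, u).
Proof. by rewrite /shifted_kernel /log_kernel/= eq_sym distrC. Qed.

(** Empirical measures have infinite energy because of the diagonal; after truncation each diagonal
    term costs at most A. The minimum is finite for A >= 0, so [fine] loses nothing. *)
Definition trunc_kernel (A : R) (z : R * R) : R := fine (mine (shifted_kernel b z) A%:E).

Lemma trunc_kernelE A z : 0 <= A -> (trunc_kernel A z)%:E = mine (shifted_kernel b z) A%:E.
Proof.
move=> A0; rewrite /trunc_kernel fineK//; have := shifted_kernel_ge0 b z.
by case: (shifted_kernel b z) => [r||]// _; rewrite /mine; case: ifP.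
Qed.

Lemma trunc_kernel_ge0 A z : 0 <= A -> 0 <= trunc_kernel A z.
Proof. by move=> A0; rewrite -lee_fin trunc_kernelE// le_min shifted_kernel_ge0 lee_fin. Qed.

Lemma trunc_kernel_le A z : 0 <= A -> trunc_kernel A z <= A.
Proof. by move=> A0; rewrite -lee_fin trunc_kernelE// ge_min lexx orbT. Qed.

Lemma trunc_kernelC A (u v : R) : trunc_kernel A (u, v) = trunc_kernel A (v, u).
Proof. by rewrite /trunc_kernel shifted_kernelC. Qed.

Lemma measurable_trunc_kernel A : 0 <= A ->
  measurable_fun setT (fun z => (trunc_kernel A z)%:E).
Proof.
move=> A0; under eq_fun do rewrite trunc_kernelE//.
by apply: measurable_mine => //; exact: measurable_shifted_kernel.
Qed.

End truncated_kernel.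

(** * Leja points and their empirical measures *)

Section leja.
Context {R : realType}.
Variables (K : set R) (c : R).
Hypothesis c0 : 0 < c.

(** The next point need not maximise the monic polynomial whose roots are the earlier points; a
    value of at least [c ^+ n] is enough. *)
Lemma leja_points : K !=set0 ->
  (forall (N : nat) (f : {poly R}), (0 < N)%N -> f \is monic -> size f = N.+1 ->
     exists2 x, K x & c ^+ N <= `|f.[x]|) ->
  exists x : nat -> R, forall n, K (x n) /\ c ^+ n <= \prod_(i < n) `|x i - x n|.
Proof.
move=> [z Kz] H.
have step (s : seq R) : exists y, K y /\ c ^+ size s <= \prod_(u <- s) `|u - y|.
  case: s => [|a s]; first by exists z; rewrite big_nil expr0.
  have [||y Ky cy] := H (size s).+1 (\prod_(u <- a :: s) ('X - u%:P)) isT.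
  - exact: monic_prod_XsubC.
  - by rewrite size_prod_XsubC.
  exists y; split=> //; move: cy; rewrite horner_prod normr_prod => /le_trans; apply.
  by apply: ler_prod => u _; rewrite normr_ge0 hornerXsubC distrC lexx.
pose nxt s := projT1 (cid (step s)).
have nxtP s : K (nxt s) /\ c ^+ size s <= \prod_(u <- s) `|u - nxt s|.
  exact: (projT2 (cid (step s))).
pose pts := fix pts n := if n is m.+1 then rcons (pts m) (nxt (pts m)) else [::].
pose x n := nxt (pts n).
have ptsE n : pts n = mkseq x n.
  by elim: n => [//|n IH]; rewrite mkseqS -IH.
exists x => n; have [Kx cx] := nxtP (pts n); split=> //.
move: cx; rewrite -/(x n) ptsE size_mkseq.
have -> : mkseq x n = [seq x i | i <- index_iota 0 n] by rewrite /index_iota subn0.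
by rewrite big_map big_mkord.
Qed.

Variables (b : R) (x : nat -> R).
Hypothesis Kb : forall n m, `|x n - x m| <= expR b.
Hypothesis xc : forall n, c ^+ n <= \prod_(i < n) `|x i - x n|.

Lemma leja_row (A : R) (n : nat) : 0 <= A ->
  \sum_(i < n) trunc_kernel b A (x i, x n) <= n%:R * (b - ln c).
Proof.
move=> A0.
have P0 : 0 < \prod_(i < n) `|x i - x n| by apply: lt_le_trans (xc n); rewrite exprn_gt0.
have xx (i : 'I_n) : 0 < `|x i - x n|.
  rewrite normr_gt0; apply: contraTneq P0 => E.
  by rewrite (bigD1 i)//= E normr0 mul0r ltxx.
apply: (@le_trans _ _ (\sum_(i < n) (b - ln `|x i - x n|))).
  apply: ler_sum => i _; rewrite -lee_fin trunc_kernelE// ge_min; apply/orP; left.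
  have := xx i; rewrite normr_gt0 subr_eq0 => xin.
  rewrite shifted_kernelE//= /log_kernel/=; case: ifPn => [E|_].
    by move/negP: xin; case.
  by rewrite -EFinD lee_fin addrC.
rewrite sumrB sumr_const card_ord mulrBr mulr_natl lerD2l lerN2.
have -> : \sum_(i < n) ln `|x i - x n| = ln (\prod_(i < n) `|x i - x n|).
  apply: expR_inj; rewrite lnK ?posrE// expR_sum; apply: eq_bigr => i _.
  by rewrite lnK// posrE.
by rewrite mulr_natl -lnXn// ler_ln ?posrE ?exprn_gt0.
Qed.

(** N diagonal terms of at most A, and each row counted twice by symmetry: 2 (0 + 1 + ... + (N - 1))
    = N (N - 1). *)
Lemma leja_energy (A : R) (N : nat) : 0 <= A ->
  \sum_(i < N) \sum_(j < N) trunc_kernel b A (x i, x j) <=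
    N%:R * A + N%:R * (N%:R - 1) * (b - ln c).
Proof.
move=> A0; elim: N => [|N IH]; first by rewrite !big_ord0 !mul0r addr0.
rewrite big_ord_recr/=; under eq_bigr do rewrite big_ord_recr/=.
rewrite big_split/= big_ord_recr/=.
have E : \sum_(i < N) trunc_kernel b A (x N, x i) = \sum_(i < N) trunc_kernel b A (x i, x N).
  by apply: eq_bigr => i _; rewrite trunc_kernelC.
have := leja_row N A0; have := trunc_kernel_le b (x N, x N) A0.
rewrite E -natr1; move: IH; lra.
Qed.

(* Quantile function of the empirical measure of [x 0, ..., x (N - 1)], which is thus the image
   of the uniform measure on [0, 1]. *)
Definition quantile (N : nat) (t : R) : R :=
  nth 0 (sort <=%R (mkseq x N)) (grid_index N t).

Lemma quantile_homo N : (0 < N)%N -> {homo quantile N : s t / s <= t}.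
Proof.
move=> N0 s t st; rewrite /quantile.
apply: (sorted_leq_nth le_trans lexx) => //.
- by apply: sort_sorted; exact: le_total.
- by rewrite inE size_sort size_mkseq grid_index_lt.
- by rewrite inE size_sort size_mkseq grid_index_lt.
- exact: grid_index_homo.
Qed.

Lemma quantile_in N t : (0 < N)%N -> exists n, quantile N t = x n.
Proof.
move=> N0; have : quantile N t \in sort <=%R (mkseq x N).
  by rewrite mem_nth// size_sort size_mkseq grid_index_lt.
by rewrite mem_sort => /mapP[n _ ->]; exists n.
Qed.

Lemma quantile_energy (A : R) (N : nat) : 0 <= A -> (0 < N)%N -> 0 <= b - ln c ->
  (\int[uniform_prob (@ltr01 R)]_s \int[uniform_prob (@ltr01 R)]_t
     (trunc_kernel b A (quantile N s, quantile N t))%:E <=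
   (A / N%:R + (b - ln c))%:E)%E.
Proof.
move=> A0 N0 v0; have NR : 0 < N%:R :> R by rewrite ltr0n.
pose p k := nth 0 (sort <=%R (mkseq x N)) k.
pose G k := N%:R^-1 * \sum_(l < N) trunc_kernel b A (p k, p l).
have t0 z : 0 <= trunc_kernel b A z by exact: trunc_kernel_ge0.
have inner (s : R) : (\int[uniform_prob (@ltr01 R)]_t
     (trunc_kernel b A (quantile N s, quantile N t))%:E = (G (grid_index N s))%:E)%E.
  exact: (integral_grid (G := fun l => trunc_kernel b A (quantile N s, p l))).
under eq_integral do rewrite inner.
rewrite integral_grid//; last by move=> k; rewrite mulr_ge0 ?invr_ge0 ?sumr_ge0.
have E : \sum_(k < N) \sum_(l < N) trunc_kernel b A (p k, p l) =
    \sum_(k < N) \sum_(l < N) trunc_kernel b A (x k, x l).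
  have sz : size (sort <=%R (mkseq x N)) = N by rewrite size_sort size_mkseq.
  have W (g : R -> R) : \sum_(k < N) g (p k) = \sum_(k < N) g (x k).
    transitivity (\sum_(u <- sort <=%R (mkseq x N)) g u).
      by rewrite (big_nth 0) sz big_mkord.
    rewrite (perm_big (mkseq x N)) ?perm_sort//.
    have -> : mkseq x N = [seq x i | i <- index_iota 0 N] by rewrite /index_iota subn0.
    by rewrite big_map big_mkord.
  rewrite (W (fun u => \sum_(l < N) trunc_kernel b A (u, p l))).
  by apply: eq_bigr => k _; rewrite (W (fun u => trunc_kernel b A (x k, u))).
rewrite lee_fin /G -mulr_sumr E mulrA -invfM mulrC ler_pdivrMr ?mulr_gt0//.
apply: le_trans (leja_energy _ A0) _.
have -> : (A / N%:R + (b - ln c)) * (N%:R * N%:R) = N%:R * A + N%:R * N%:R * (b - ln c).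
  by field; rewrite gt_eqF.
by rewrite lerD2l ler_wpM2r// ler_pM2l//; lra.
Qed.

End leja.

(** * Selection of a limit and its energy *)

Section fekete_szego.
Context {R : realType}.

(** Helly's selection theorem. An ultrafilter yields the limit at every t at once and preserves
    monotonicity; Fatou's lemma needs a sequence, which is extracted along the countably many
    rationals. The growth (n + 1)^2 makes n / [sub n] tend to 0, n being the truncation level used
    later. *)
Lemma ultra_quantile_limit (Q : nat -> R -> R) (K : set R) : compact K ->
  (forall N t, (0 < N)%N -> K (Q N t)) ->
  (forall N, (0 < N)%N -> {homo Q N : s t / s <= t}) ->
  exists q : R -> R, [/\ forall t, K (q t), {homo q : s t / s <= t} &
    exists2 sub : nat -> nat, (forall n, (n.+1 ^ 2 <= sub n)%N) &
      forall (r : rat) (e : R), 0 < e -> exists n0, forall n, (n0 <= n)%N ->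
        `|Q (sub n) (ratr r) - q (ratr r)| < e].
Proof.
move=> cK QK Qh.
have [U [UU Uoo]] := ultraFilterLemma (eventually_filter : ProperFilter \oo).
have Uge m : U [set N | (m <= N)%N] by apply: Uoo; exact: nbhs_infty_ge.
have lim t : exists l, K l /\ forall e, 0 < e -> U [set N | `|Q N t - l| < e].
  have FK : U [set N | K (Q N t)].
    by apply: filterS (Uge 1%N) => N N0; apply: QK.
  have [l [Kl cl]] := cK (fmap (Q^~ t) U) _ FK.
  exists l; split=> // e e0.
  have [//|UC] := in_ultra_setVsetC [set N | `|Q N t - l| < e] UU.
  have Ul : (fmap (Q^~ t) U) [set y | ~ `|y - l| < e] by [].
  have [y /= [yl1 yl2]] := cl _ _ Ul (nbhsx_ballx l e e0).
  by case: yl1; rewrite distrC.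
pose q t := projT1 (cid (lim t)).
have qP t : K (q t) /\ forall e, 0 < e -> U [set N | `|Q N t - q t| < e].
  exact: (projT2 (cid (lim t))).
(* Stage n controls only the rationals of code below n, a finite intersection of sets of [U]. *)
have H n : exists N, (n.+1 ^ 2 <= N)%N /\ forall r : rat, (pickle r < n)%N ->
    `|Q N (ratr r) - q (ratr r)| < n.+1%:R^-1.
  have n0 : 0 < n.+1%:R^-1 :> R by rewrite invr_gt0.
  have Um m : U [set N | forall r : rat, (pickle r < m)%N ->
      `|Q N (ratr r) - q (ratr r)| < n.+1%:R^-1].
    elim: m => [|m IH]; first by apply: filterS (Uge 0%N).
    have Sm : U [set N | forall r : rat, pickle r = m ->
        `|Q N (ratr r) - q (ratr r)| < n.+1%:R^-1].
      case E : (@unpickle rat m) => [r0|].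
        apply: filterS ((qP (ratr r0)).2 _ n0) => N /= HN r rm.
        by move: E; rewrite -rm pickleK => -[->].
      by apply: filterS (Uge 0%N) => N _ r rm; move: E; rewrite -rm pickleK.
    apply: filterS (filterI IH Sm) => N /= [H1 H2] r; rewrite ltnS leq_eqVlt.
    by case/orP => [/eqP|]; [exact: H2|exact: H1].
  by have [N [N1 N2]] := filter_ex (filterI (Uge (n.+1 ^ 2)%N) (Um n)); exists N.
exists q; split.
- by move=> t; have [] := qP t.
- move=> s t st; rewrite leNgt; apply/negP => qts.
  have e0 : 0 < (q s - q t) / 2 by rewrite divr_gt0// subr_gt0.
  have [N /= [[N0 Ns] Nt]] := filter_ex (filterI (filterI (Uge 1%N)
    ((qP s).2 _ e0)) ((qP t).2 _ e0)).
  have := Qh N N0 _ _ st; move: Ns Nt => /=; rewrite !ltr_norml => /andP[? ?] /andP[? ?]; lra.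
exists (fun n => projT1 (cid (H n))) => [n|r e e0]; first by have [] := projT2 (cid (H n)).
exists (maxn (pickle r).+1 (Num.truncn e^-1).+1) => n; rewrite geq_max => /andP[rn en].
have [_ /(_ _ rn) /lt_trans -> //] := projT2 (cid (H n)).
rewrite -[e]invrK ltf_pV2 ?posrE ?invr_gt0//.
by apply: lt_le_trans (truncnS_gt _) _; rewrite ler_nat; exact: leqW.
Qed.

(** At a continuity point t, monotonicity squeezes the values at t between those at two nearby
    rationals. *)
Lemma homo_cvg (q : R -> R) (Q : nat -> R -> R) (t : R) :
  {homo q : s t / s <= t} -> (forall n, {homo Q n : s t / s <= t}) ->
  (forall (r : rat) (e : R), 0 < e -> exists n0, forall n, (n0 <= n)%N ->
     `|Q n (ratr r) - q (ratr r)| < e) ->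
  ~ jumps q t -> forall e, 0 < e -> exists n0, forall n, (n0 <= n)%N -> `|Q n t - q t| < e.
Proof.
move=> qh Qh cv tJ e e0; have e20 : 0 < e / 2 by rewrite divr_gt0.
have [d d0 td] := not_jumps tJ e20.
have td1 : t - d < t by rewrite ltrBlDr ltrDl.
have [r1] := rat_in_itvoo td1.
rewrite in_itv/= => /andP[dr1 r1t].
have td2 : t < t + d by rewrite ltrDl.
have [r2] := rat_in_itvoo td2.
rewrite in_itv/= => /andP[tr2 r2d].
have [n1 H1] := cv r1 _ e20; have [n2 H2] := cv r2 _ e20.
exists (maxn n1 n2) => n; rewrite geq_max => /andP[/H1 {}H1 /H2 {}H2].
have a1 := Qh n _ _ (ltW r1t); have a2 := Qh n _ _ (ltW tr2).
have b1 := qh _ _ (ltW dr1); have b2 := qh _ _ (ltW r2d).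
have b3 := qh _ _ (ltW r1t); have b4 := qh _ _ (ltW tr2).
move: H1 H2; rewrite !ltr_norml => /andP[? ?] /andP[? ?]; apply/andP; split; lra.
Qed.

(* Otherwise there are Leja points with products at least [c ^+ n]; the quantile functions of
   their empirical measures converge to one whose image measure has energy at most [- ln c]. *)
Lemma fekete_szego (K : set R) (c : R) : compact K -> nonpolar K -> Cap K < c ->
  exists (N : nat) (f : {poly R}), [/\ (0 < N)%N, f \is monic, size f = N.+1 &
    forall x, K x -> `|f.[x]| < c ^+ N].
Proof.
move=> cK npK Capc; apply: contrapT => H.
have c0 : 0 < c by apply: lt_trans Capc; exact: Cap_gt0.
have K0 : K !=set0.
  by have [x [_ Kx]] := nonpolar_points cK npK 0; exists (x ord0).
have [|x xP] := @leja_points R K c K0.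
  move=> N f N0 fm fs; apply: contrapT => H1; apply: H; exists N, f; split=> // y Ky.
  by rewrite ltNge; apply/negP => cy; apply: H1; exists y.
have Kx n : K (x n) by have [] := xP n.
have xc n : c ^+ n <= \prod_(i < n) `|x i - x n| by have [] := xP n.
have [clK [b b0 [_ Kb]]] := compact_realP cK.
have xb n m : `|x n - x m| <= expR b by exact: Kb.
have v0 : 0 <= b - ln c.
  have := leja_row c0 xb xc 1 (lexx 0).
  rewrite mul1r; apply: le_trans; apply: sumr_ge0 => i _; exact: trunc_kernel_ge0.
have [||q [Kq qh [sub subn cv]]] := @ultra_quantile_limit (quantile x) K cK.
- by move=> N t N0; have [n ->] := quantile_in x t N0.
- by move=> N N0; exact: quantile_homo.
pose Q n := quantile x (sub n).
have sub0 n : (0 < sub n)%N by apply: leq_trans (subn n); rewrite expn_gt0.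
have Qh n : {homo Q n : s t / s <= t} by exact: quantile_homo.
pose P := uniform_prob (@ltr01 R).
have mhomo (g : R -> R) : {homo g : s t / s <= t} ->
    @measurable_fun _ _ (measurableTypeR R) R setT g.
  move=> gh; have := @nondecreasing_measurable R setT g measurableT.
  by apply => s t; exact: gh.
pose X : {mfun (measurableTypeR R) >-> R} := @mfun_Sub _ _ (measurableTypeR R) R q (mem_set (mhomo q qh)).
pose mu : probability R R := distribution P X.
have muK : mu (~` K) = 0%E.
  rewrite -[LHS]/(P (X @^-1` (~` K))).
  have -> : X @^-1` (~` K) = set0 by apply/seteqP; split=> // t /=; have := Kq t.
  exact: measure0.
have mpair (g : R -> R) : {homo g : s t / s <= t} ->
    @measurable_fun _ _ (measurableTypeR R * measurableTypeR R)%type (R * R)%type setT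
      (fun z => (g z.1, g z.2)).
  move=> gh; apply: measurable_fun_pair.
    by apply: measurableT_comp; [exact: (mhomo g gh)|exact: measurable_fst].
  by apply: measurableT_comp; [exact: (mhomo g gh)|exact: measurable_snd].
pose f n (s t : R) := (trunc_kernel b n%:R (Q n s, Q n t))%:E.
have key : (\int[P]_s \int[P]_t shifted_kernel b (q s, q t) <= (b - ln c)%:E)%E.
  have mf n : @measurable_fun _ _ (measurableTypeR R * measurableTypeR R)%type _ setT
      (fun z => f n z.1 z.2).
    apply: (measurableT_comp (measurable_trunc_kernel b (ler0n R n))).
    exact: (mpair _ (Qh n)).
  have mf1 n s : @measurable_fun _ _ (measurableTypeR R) _ setT (fun t => f n s t).
    exact: (measurableT_comp (mf n) (measurable_pair1 s)).
  have mf2 n : @measurable_fun _ _ (measurableTypeR R) _ setT (fun s => \int[P]_t f n s t)%E.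
    exact: measurable_integral_snd (mf n).
  have f0 n s t : (0 <= f n s t)%E by rewrite lee_fin trunc_kernel_ge0.
  (* Fatou is used in t and in s. Off the jumps of [q], a countable null set, the kernel at the
     limit is at most the lower limit of the [f n], by semicontinuity and because the truncation
     level n tends to infinity. *)
  apply: (@le_trans _ _ (\int[P]_s limn_einf (fun n => \int[P]_t f n s t))%E).
    have P0 : P (jumps q) = 0%E.
      have cj := countable_jumps qh.
      have /null_content_dominatesP := @dominates_uniform_prob R 0 1 ltr01; apply.
        by apply: countable_measurable => //.
      exact: countable_lebesgue_measure0.
    have mj : measurable (jumps q : set (measurableTypeR R)).
      by apply: countable_measurable => //; exact: countable_jumps.
    have aej (F G : R -> \bar R) : (forall t, ~ jumps q t -> (F t <= G t)%E) ->
        {ae P, forall t, setT t -> (F t <= G t)%E}.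
      move=> FG; exists (jumps q); split=> // t /= H1; apply: contrapT => tj.
      by apply: H1 => _; exact: FG.
    have mh : @measurable_fun _ _ (measurableTypeR R * measurableTypeR R)%type _ setT
        (fun z => shifted_kernel b (q z.1, q z.2)).
      exact: (measurableT_comp (measurable_shifted_kernel b) (mpair _ qh)).
    have mlim (F : nat -> R -> \bar R) :
        (forall n, @measurable_fun _ _ (measurableTypeR R) _ setT (F n)) ->
        @measurable_fun _ _ (measurableTypeR R) _ setT (fun t => limn_einf (F^~ t)).
      move=> mF; apply: (@emeasurable_fun_cvg _ _ _ setT (fun n t => einfs (F^~ t) n)).
        by move=> n; exact: measurable_fun_einfs.
      by move=> t _; rewrite limn_einf_lim; exact: is_cvg_einfs.
    have lim0 (u : nat -> \bar R) : (forall n, (0 <= u n)%E) -> (0 <= limn_einf u)%E.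
      by move=> u0; apply: limn_einf_geP => y y0; exists 0%N => n _; rewrite (le_trans (ltW y0)).
    apply: ae_ge0_le_integral => //.
    - by move=> s _; apply: integral_ge0 => t _; exact: shifted_kernel_ge0.
    - exact: measurable_integral_snd mh.
    - by move=> s _; apply: lim0 => n; exact: integral_ge0.
    - exact: mlim.
    apply: (aej) => s sj; apply: le_trans (fatou P measurableT (fun n => mf1 n s) _); last first.
      by move=> n t _; exact: f0.
    apply: ae_ge0_le_integral => //.
    - by move=> t _; exact: shifted_kernel_ge0.
    - exact: (measurableT_comp mh (measurable_pair1 s)).
    - by move=> t _; exact: lim0.
    - by apply: mlim => n; exact: mf1.
    apply: (aej) => t tj; apply: limn_einf_geP => y /shifted_kernel_gt[y0|yst].
      by exists 0%N => n _; apply: le_trans (f0 n s t); rewrite lee_fin ltW.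
    have e0 : 0 < (expR (b - y) - `|q s - q t|) / 2 by rewrite divr_gt0// subr_gt0.
    have [n1 H1] := homo_cvg qh Qh cv sj e0; have [n2 H2] := homo_cvg qh Qh cv tj e0.
    exists (maxn (maxn n1 n2) (Num.truncn y).+1) => n.
    rewrite !geq_max => /andP[/andP[/H1 {}H1 /H2 {}H2] yn].
    rewrite /f trunc_kernelE// le_min; apply/andP; split.
      apply: shifted_kernel_ge.
      have -> : Q n s - Q n t = (Q n s - q s) - (Q n t - q t) + (q s - q t) by ring.
      apply: le_lt_trans (ler_normD _ _) _.
      have := ler_normB (Q n s - q s) (Q n t - q t); lra.
    by rewrite lee_fin ltW// (lt_le_trans (truncnS_gt _))// ler_nat.
  apply: le_trans (fatou P measurableT mf2 _) _.
    by move=> n s _; exact: integral_ge0.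
  apply: limn_einf_leP => e n e0.
  (* The diagonal contributes k / [sub k] <= 1 / k <= e. *)
  pose k := maxn n (Num.truncn e^-1).+1.
  exists k; first exact: leq_maxl.
  apply: le_trans (quantile_energy c0 xb xc (ler0n R k) (sub0 k) v0) _.
  rewrite lee_fin addrC lerD2l ler_pdivrMr ?ltr0n//.
  have ek : 1 <= e * k%:R.
    rewrite -ler_pdivrMl// mulr1 ltW// (lt_le_trans (truncnS_gt _))// ler_nat.
    exact: leq_maxr.
  have kk : k%:R * k%:R <= (sub k)%:R :> R.
    by rewrite -natrM ler_nat (leq_trans _ (subn k))// -mulnn leq_mul.
  apply: (@le_trans _ _ (e * (k%:R * k%:R))); last by rewrite ler_pM2l.
  by rewrite mulrA ler_peMl.
have : (log_energy mu <= (- ln c)%:E)%E.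
  rewrite (log_energy_shift b0 clK muK Kb).
  have -> : (\int[mu]_x \int[mu]_y shifted_kernel b (x, y) =
      \int[P]_s \int[P]_t shifted_kernel b (q s, q t))%E.
    have mh := measurable_shifted_kernel b.
    rewrite ge0_integral_distribution; last 2 first.
    - exact: (measurable_integral_snd mu mh).
    - by move=> y; apply: integral_ge0 => z _; exact: shifted_kernel_ge0.
    apply: eq_integral => s _ /=; rewrite ge0_integral_distribution//.
    - exact: (measurableT_comp mh (measurable_pair1 (q s))).
    - by move=> y; exact: shifted_kernel_ge0.
  have -> : (- ln c)%:E = ((b - ln c)%:E - b%:E)%E by rewrite -EFinB; congr (_%:E); lra.
  exact: leeB.
move=> /(Cap_ge cK npK muK); rewrite opprK lnK ?posrE// leNgt.
by rewrite Capc.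
Qed.

End fekete_szego.

Lemma exp_le_prod (F : numDomainType) (T : eqType) (s : seq T) (f : T -> F) (a : F) :
  0 <= a -> (forall z, z \in s -> a <= f z) -> a ^+ size s <= \prod_(z <- s) f z.
Proof.
move=> a0; elim: s => [|z s IH] H; first by rewrite big_nil expr0.
rewrite big_cons /= exprS; apply: ler_pM; rewrite ?exprn_ge0//.
  by apply: H; rewrite mem_head.
by apply: IH => v vs; apply: H; rewrite inE vs orbT.
Qed.

(** * Polynomial preimages of [-1, 1] *)

Section graeffe.
Context {R : realType}.
Local Notation C := R[i].
Local Notation rc := (real_complex R).

(** The monic polynomial with roots [s] is at most [eta] on [-2, 2], the interval that u^2 - 2 maps
    onto itself. *)
Definition bounded_prod (s : seq C) (eta : R) : Prop :=
  forall u : R, -2 <= u <= 2 -> \prod_(z <- s) `|rc u - z| <= rc eta.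

Lemma bounded_prod_ge0 s eta : bounded_prod s eta -> 0 <= eta.
Proof.
move=> H; rewrite -lecR; apply: le_trans (H 0 _); last by apply/andP; split; lra.
by apply: prodr_ge0.
Qed.

(* The map [u |-> u^2 - 2] sends [-2, 2] onto itself, and
   [u^2 - 2 - (z^2 - 2) = (u - z) (u + z)]. *)
Lemma bounded_prod_double s eta : bounded_prod s eta ->
  bounded_prod [seq z ^+ 2 - 2 | z <- s] (eta ^+ 2).
Proof.
move=> H u /andP[u1 u2]; have H0 := bounded_prod_ge0 H.
have w0 : 0 <= Num.sqrt (u + 2) by exact: sqrtr_ge0.
have w2 : Num.sqrt (u + 2) ^+ 2 = u + 2 by rewrite sqr_sqrtr//; lra.
move: w0 w2; set w := Num.sqrt _ => w0 w2.
have wle : w <= 2 by nra.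
have -> : \prod_(z <- [seq z ^+ 2 - 2 | z <- s]) `|rc u - z| =
    \prod_(z <- s) `|rc w - z| * \prod_(z <- s) `|rc (- w) - z|.
  rewrite big_map -big_split/=; apply: eq_bigr => z _.
  rewrite -normrM; have -> : rc u = rc w ^+ 2 - 2.
    by rewrite -rmorphXn w2 rmorphD rmorph_nat addrK.
  have -> : rc w ^+ 2 - 2 - (z ^+ 2 - 2) = - ((rc w - z) * (- rc w - z)) by ring.
  by rewrite normrN rmorphN.
rewrite expr2 rmorphM; apply: ler_pM; rewrite ?prodr_ge0//; apply: H; lra.
Qed.

(** Pigeonhole: with h = 1/(d+1), the d + 1 points 2 h i of [0, 2] are 2h apart, so the d open discs
    of radius h about the roots miss one of them. *)
Lemma bounded_prod_lb s eta : bounded_prod s eta ->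
  ((size s).+1%:R^-1) ^+ size s <= eta.
Proof.
move=> H; set d := size s; set h : R := d.+1%:R^-1.
have d0 : 0 < d.+1%:R :> R by rewrite ltr0n.
have h0 : 0 < h by rewrite invr_gt0.
pose u (i : 'I_d.+1) : R := (2 * h) * i%:R.
suff [i Hi] : exists i, forall z, z \in s -> rc h <= `|rc (u i) - z|.
  have ui : -2 <= u i <= 2.
    apply/andP; split; first by apply: (@le_trans _ _ 0); rewrite ?oppr_le0// !mulr_ge0// ltW.
    rewrite /u -mulrA -[leRHS]mulr1 ler_pM2l// mulrC ler_pdivrMr// mul1r ler_nat.
    by rewrite ltnW.
  rewrite -lecR; apply: le_trans (H _ ui).
  by rewrite rmorphXn; apply: exp_le_prod; rewrite ?ler0c ?ltW.
apply: contrapT => nH.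
have cl (i : 'I_d.+1) : exists j : 'I_d, `|rc (u i) - nth 0 s j| < rc h.
  apply: contrapT => nj; apply: nH; exists i => z zs.
  have zi : (index z s < d)%N by rewrite index_mem.
  rewrite real_leNgt ?realr ?normr_real//; last by apply/complex_realP; exists h.
  apply/negP => lt; apply: nj; exists (Ordinal zi); by rewrite /= nth_index.
pose g i := projT1 (cid (cl i)).
have gP i : `|rc (u i) - nth 0 s (g i)| < rc h by exact: (projT2 (cid (cl i))).
have gI : injective g.
  move=> i j gij; apply/eqP; apply: contraT => ij.
  have : `|rc (u i) - rc (u j)| < rc (h + h).
    have -> : rc (u i) - rc (u j) = (rc (u i) - nth 0 s (g i)) - (rc (u j) - nth 0 s (g j)).
      by rewrite gij; ring.
    by rewrite (le_lt_trans (ler_normB _ _))// rmorphD ltrD.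
  rewrite -rmorphB normc_def/= expr0n/= addr0 sqrtr_sqr ltcR ltNge => /negP; case.
  rewrite /u -mulrBr normrM (gtr0_norm (_ : 0 < 2 * h)) ?mulr_gt0//.
  suff : 1 <= `|i%:R - j%:R| :> R by move=> ?; nra.
  have [lij|lij|/val_inj eij] := ltngtP i j; last by rewrite eij eqxx in ij.
  - by rewrite distrC -natrB 1?ltnW// normr_nat ler1n subn_gt0.
  - by rewrite -natrB 1?ltnW// normr_nat ler1n subn_gt0.
have := leq_card g gI; by rewrite !card_ord ltnn.
Qed.

(** Doubling squares [eta] but keeps the number of roots, on which alone the pigeonhole bound
    depends. *)
Lemma bounded_prod_ge1 s eta : bounded_prod s eta -> 1 <= eta.
Proof.
move=> H; have e0 := bounded_prod_ge0 H.
pose dl : R := ((size s).+1%:R^-1) ^+ size s.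
have dl0 : 0 < dl by rewrite exprn_gt0// invr_gt0.
apply: (@le_of_expr2n_le _ _ _ dl^-1) => // k.
rewrite expr1n ler_pdivlMl// mulr1.
have [s' [ss Hs]] : exists s', size s' = size s /\ bounded_prod s' (eta ^+ (2 ^ k)).
  elim: k => [|k [s' [ss Hs]]]; first by exists s.
  exists [seq z ^+ 2 - 2 | z <- s']; rewrite size_map; split=> //.
  by rewrite expnS mulnC exprM; exact: bounded_prod_double.
by rewrite /dl -ss; exact: bounded_prod_lb.
Qed.

(** Exchanging the double product over the roots z of g and w of p - u/2 turns the product of the |u
    - 2 p(z)| into (2 |lead p|)^N times that of the |g(w)|; for u in [-2, 2] all w lie in K. *)
Lemma preimage_ge1 (K : set R) (p : {poly C}) (k N : nat) (g : {poly R}) (B : R) :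
  size p = k.+1 ->
  (forall z, (complex.Im p.[z] = 0 /\ -1 <= complex.Re p.[z] <= 1) ->
     complex.Im z = 0 /\ K (complex.Re z)) ->
  (0 < k)%N -> g \is monic -> size g = N.+1 -> (forall x, K x -> `|g.[x]| <= B) ->
  1 <= (2 * ComplexField.Normc.normc (lead_coef p)) ^+ N * B ^+ k.
Proof.
move=> ps pK k0 gm gs gB; set A := ComplexField.Normc.normc _.
have AE : `|lead_coef p| = rc A by [].
pose gC := map_poly rc g.
have [zs gE] := closed_field_poly_normal gC.
have gCm : lead_coef gC = 1 by rewrite lead_coef_map (monicP gm) rmorph1.
rewrite gCm scale1r in gE.
have zsN : size zs = N.
  by have := size_map_poly rc g; rewrite -/gC gE size_prod_XsubC gs => -[].
apply: (@bounded_prod_ge1 [seq 2 * p.[z] | z <- zs]) => u u2.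
pose pu := p - (rc (u / 2))%:P.
have pus : size pu = k.+1.
  rewrite size_polyDl ?ps// size_polyN ltnS (leq_trans (size_polyC_leq1 _))//.
have pul : lead_coef pu = lead_coef p.
  by rewrite lead_coefDl// size_polyN ps ltnS (leq_trans (size_polyC_leq1 _)).
have [ws puE] := closed_field_poly_normal pu.
have ln0 : lead_coef p != 0 by rewrite lead_coef_eq0 -size_poly_eq0 ps.
have wsk : size ws = k.
  by move: pus; rewrite puE pul size_scale// size_prod_XsubC => -[].
have wsP w : w \in ws -> exists2 x, K x & w = rc x.
  move=> wws; have : root pu w by rewrite puE pul rootZ// root_prod_XsubC.
  rewrite /root hornerD hornerN hornerC subr_eq0 => /eqP pw.
  have [|Imw KRw] := pK w; first by rewrite pw /=; split=> //; lra.
  by exists (complex.Re w) => //; apply/eqP; rewrite eq_complex/= Imw !eqxx.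
rewrite big_map.
have E z : z \in zs -> `|rc u - 2 * p.[z]| = 2 * rc A * \prod_(w <- ws) `|z - w|.
  move=> _; have -> : rc u - 2 * p.[z] = - 2 * pu.[z].
    rewrite /pu hornerD hornerN hornerC mulrBr !mulNr opprK addrC; congr (_ + _).
    by rewrite rmorphM mulrCA fmorphV rmorph_nat divff ?mulr1// pnatr_eq0.
  rewrite puE pul hornerZ horner_prod normrM normrN normr_nat -mulrA; congr (_ * _).
  rewrite normrM AE normr_prod; congr (_ * _); apply: eq_bigr => w _.
  by rewrite hornerXsubC.
rewrite (eq_big_seq _ E) big_split/= big_const_seq count_predT iter_mulr_1 zsN.
rewrite rmorphM rmorphXn rmorphM rmorph_nat; apply: ler_wpM2l.
  by rewrite exprn_ge0// mulr_ge0// -AE.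
rewrite exchange_big/= rmorphXn -wsk.
have H w : w \in ws -> 0 <= \prod_(z <- zs) `|z - w| <= rc B.
  move=> /wsP[x Kx ->]; rewrite prodr_ge0//=.
  have -> : \prod_(z <- zs) `|z - rc x| = `|gC.[rc x]|.
    rewrite gE horner_prod normr_prod; apply: eq_bigr => z _.
    by rewrite hornerXsubC distrC.
  rewrite /gC horner_map normc_def/= expr0n/= addr0 sqrtr_sqr lecR; exact: gB.
elim: (ws) H => [|w l IH] H; first by rewrite big_nil expr0.
rewrite big_cons /= exprS; have /andP[h1 h2] := H w (mem_head _ _).
apply: ler_pM => //; first by apply: prodr_ge0 => v _; apply: prodr_ge0.
by apply: IH => v vl; apply: H; rewrite inE vl orbT.
Qed.

(** For c > Cap K, Fekete-Szego gives a monic g of some degree N > 0 below c^N on K, and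
    [preimage_ge1] becomes 1 <= (2 A c^k)^N, so 2 A c^k >= 1. *)
Lemma preimage_Cap (K : set R) (k : nat) (p : {poly C}) : compact K -> nonpolar K ->
  size p = k.+1 ->
  (forall z, (complex.Im p.[z] = 0 /\ -1 <= complex.Re p.[z] <= 1) ->
     complex.Im z = 0 /\ K (complex.Re z)) ->
  (0 < k)%N -> 1 <= 2 * ComplexField.Normc.normc (lead_coef p) * Cap K ^+ k.
Proof.
move=> cK npK ps pK k0; set A := ComplexField.Normc.normc _.
have C0 := Cap_gt0 cK npK.
have A0 : 0 < A.
  rewrite -ltcR -[A%:C%C]/(`|lead_coef p|) normr_gt0 lead_coef_eq0 -size_poly_eq0 ps//.
have H c : Cap K < c -> 1 <= 2 * A * c ^+ k.
  move=> Cc; have c0 := lt_trans C0 Cc.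
  have [N [g [N0 gm gs gc]]] := fekete_szego cK npK Cc.
  have := preimage_ge1 ps pK k0 gm gs (fun x Kx => ltW (gc x Kx)).
  rewrite -/A -exprM mulnC exprM -exprMn => H1.
  rewrite leNgt; apply/negP => lt1; move: H1; rewrite leNgt => /negP; apply.
  by rewrite exprn_ilt1// -?lt0n// !mulr_ge0// ?exprn_ge0// ltW.
(* [b] solves 2 A b^k = 1: every c above [Cap K] is at least [b], hence so is [Cap K]. *)
pose b := expR (- ln (2 * A) / k%:R).
have kR : k%:R != 0 :> R by rewrite pnatr_eq0 -lt0n.
have bk : 2 * A * b ^+ k = 1.
  rewrite -expRM_natl; have -> : k%:R * (- ln (2 * A) / k%:R) = - ln (2 * A) by field.
  rewrite expRN lnK ?posrE ?mulr_gt0//.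
  by rewrite mulfV// gt_eqF// mulr_gt0.
have bc c : Cap K < c -> b <= c.
  move=> Cc; have c0 := lt_trans C0 Cc; have Hc := H c Cc; move: Hc.
  by rewrite -[X in X <= 2 * _ * _]bk ler_pM2l ?mulr_gt0// ler_pXn2r ?nnegrE ?expR_ge0// ltW.
rewrite -[X in X <= _]bk ler_pM2l ?mulr_gt0// ler_pXn2r ?nnegrE ?expR_ge0 ?(ltW C0)//.
rewrite leNgt; apply/negP => ltb; have := bc ((Cap K + b) / 2) _; lra.
Qed.

End graeffe.

(** * Extremal polynomials and their preimages *)

Section preimage.
Context {R : realType}.
Local Notation C := R[i].
Local Notation rc := (real_complex R).

Lemma cheb_double_comp (f : {poly R}) M k :
  cheb_double f M k = cheb_double 'X M k \Po f.
Proof.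
elim: k => [|k IH]; first by rewrite comp_polyX.
by rewrite /= IH rmorphB/= comp_polyC rmorphXn.
Qed.

Lemma cheb_double_rootC (f : {poly R}) M k (z : C) (t : R) :
  (map_poly rc f).[z] = rc (M * cos t) -> cos (t *+ (2 ^ k)) = 0 ->
  root (map_poly rc (cheb_double f M k)) z.
Proof.
move=> fz ct; rewrite /root cheb_double_comp map_comp_poly horner_comp fz horner_map.
by rewrite (cheb_double_cos k (t := t)) ?hornerX// ct mulr0 rmorph0.
Qed.

Lemma cos_halfodd (j : nat) : cos ((j%:R + 1 / 2) * pi) = 0 :> R.
Proof.
have -> : (j%:R + 1 / 2) * pi = j%:R * pi + pi / 2 :> R by ring.
rewrite cosDpihalf; apply/eqP; rewrite oppr_eq0; apply/eqP.
elim: j => [|j IH]; first by rewrite mul0r sin0.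
by rewrite -natr1 mulrDl mul1r sinDpi IH oppr0.
Qed.

Lemma cheb_nodes_dense (M t e : R) : 0 < M -> -M <= t <= M -> 0 < e ->
  exists (k : nat) (t1 t2 : R), [/\ M * cos t1 != M * cos t2,
    `|M * cos t1 - t| < e, `|M * cos t2 - t| < e,
    cos (t1 *+ (2 ^ k)) = 0 & cos (t2 *+ (2 ^ k)) = 0].
Proof.
move=> M0 /andP[t1 t2] e0.
have tM : -1 <= t / M <= 1 by rewrite ler_pdivlMr// mulN1r t1/= ler_pdivrMr// mul1r.
pose th := acos (t / M).
have th0 : 0 <= th by rewrite acos_ge0.
have thpi : th <= pi by rewrite acos_lepi.
have cth : M * cos th = t by rewrite acosK ?in_itv//= mulrC divfK ?gt_eqF.
have pi0 : 0 < pi :> R by exact: pi_gt0.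
have eM : 0 < e / M by rewrite divr_gt0.
have [d d0 Hd] : exists2 d, 0 < d & forall u, `|u - th| < d -> `|cos u - cos th| < e / M.
  have /cvgrPdist_lt/(_ _ eM) := @continuous_cos R th.
  move=> /nbhs_ballP[d /= d0 Hd]; exists d => // u ud.
  by rewrite distrC; apply: Hd; rewrite /ball/= distrC.
have Hd' u : `|u - th| < d -> `|M * cos u - t| < e.
  move=> /Hd; rewrite -cth -mulrBr normrM (gtr0_norm M0) ltr_pdivlMr// mulrC.
  by [].
(* One side of [th] suffices, chosen so as to stay in [0, pi], where [cos] is injective and the two
   nodes give distinct values. *)
have [al [be [al0 bepi ab Hab]]] : exists al be, [/\ 0 <= al, be <= pi, al < be &
    forall u, al < u < be -> `|u - th| < d].
  have [thp|thp] := ltP th pi.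
    exists th, (Num.min pi (th + d)); split=> //.
    - by rewrite ge_min lexx.
    - by rewrite lt_min thp ltrDl.
    - move=> u /andP[u1]; rewrite lt_min => /andP[_ u2].
      by rewrite ger0_norm ?subr_ge0 ?ltW// ltrBlDl.
  exists (Num.max 0 (th - d)), pi; split=> //.
  - by rewrite le_max lexx.
  - by rewrite gt_max pi0/=; lra.
  - move=> u /andP[]; rewrite gt_max => /andP[_ u1] u2.
    by rewrite ler0_norm; lra.
(* A length above 3h, with h = pi / 2^k, leaves room for two consecutive half-odd multiples of h:
   since j h <= al + h, the second is at most al + 5h/2. *)
have [k Hk] : exists k : nat, 3 * pi / (2 ^ k)%:R < be - al.
  pose n := (Num.truncn (3 * pi / (be - al))).+1; exists n.
  rewrite ltr_pdivrMr ?ltr0n ?expn_gt0// -ltr_pdivrMl ?subr_gt0// mulrC.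
  by rewrite (lt_le_trans (truncnS_gt _))// ler_nat ltnW// ltn_expl.
pose h : R := pi / (2 ^ k)%:R.
have k20 : 0 < (2 ^ k)%:R :> R by rewrite ltr0n expn_gt0.
have h0 : 0 < h by rewrite divr_gt0.
have h3 : 3 * h < be - al by rewrite /h mulrA.
pose j := (Num.truncn (al / h)).+1.
have j1 : al < j%:R * h by rewrite -ltr_pdivrMr// truncnS_gt.
have j2 : j%:R * h <= al + h.
  rewrite -natr1 mulrDl mul1r lerD2r -ler_pdivlMr// truncn_le.
  by rewrite divr_ge0// ltW.
have root_h i : cos (((i%:R + 1 / 2) * h) *+ (2 ^ k)) = 0 :> R.
  have -> : ((i%:R + 1 / 2) * h) *+ (2 ^ k) = (i%:R + 1 / 2) * pi.
    by rewrite -mulr_natr /h; field; rewrite gt_eqF.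
  exact: cos_halfodd.
have in1 : al < (j%:R + 1 / 2) * h < be by apply/andP; split; nra.
have in2 : al < (j.+1%:R + 1 / 2) * h < be.
  by rewrite -natr1; apply/andP; split; nra.
exists k, ((j%:R + 1 / 2) * h), ((j.+1%:R + 1 / 2) * h); split.
- apply/eqP => /(mulfI (lt0r_neq0 M0)) /cos_inj.
  move: in1 in2 => /andP[? ?] /andP[? ?].
  rewrite !in_itv/= => E; have : (j%:R + 1 / 2) * h = (j.+1%:R + 1 / 2) * h.
    by apply: E; apply/andP; split; lra.
  by rewrite -natr1; lra.
- exact/Hd'/Hab.
- exact/Hd'/Hab.
- exact: root_h.
- exact: root_h.
Qed.

(** The product of the distances from z to the m roots of f - t' is |t - t'| < d^m, so one of them
    is below d. *)
Lemma root_near (f : {poly R}) (m : nat) (z : C) (t t' d : R) : f \is monic ->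
  size f = m.+1 -> (0 < m)%N -> (map_poly rc f).[z] = rc t -> 0 < d ->
  `|t' - t| < d ^+ m ->
  exists2 z', (map_poly rc f).[z'] = rc t' & `|z' - z| < rc d.
Proof.
move=> fm fs m0 fz d0 tt; pose g := map_poly rc f - (rc t')%:P.
have lt : (size (- (rc t')%:P) < size (map_poly rc f))%N.
  by rewrite size_polyN size_map_poly fs (leq_ltn_trans (size_polyC_leq1 _)).
have gs : size g = m.+1 by rewrite size_polyDl// size_map_poly fs.
have gl : lead_coef g = 1 by rewrite lead_coefDl// lead_coef_map (monicP fm) rmorph1.
have [ws gE] := closed_field_poly_normal g; rewrite gl scale1r in gE.
have wsm : size ws = m by move: gs; rewrite gE size_prod_XsubC => -[].
have [[w wws wd]|H] := pselect (exists2 w, w \in ws & `|w - z| < rc d).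
  exists w => //; have : root g w by rewrite gE root_prod_XsubC.
  by rewrite /root hornerD hornerN hornerC subr_eq0 => /eqP.
exfalso; have dz : rc (d ^+ m) <= `|g.[z]|.
  rewrite gE horner_prod normr_prod rmorphXn -wsm; apply: exp_le_prod => [|w wws].
    by rewrite ler0c ltW.
  rewrite hornerXsubC distrC real_leNgt ?normr_real//; last by apply/complex_realP; exists d.
  by apply/negP => wd; apply: H; exists w.
move: dz; rewrite /g hornerD hornerN hornerC fz -rmorphB normc_def/= expr0n/= addr0.
by rewrite sqrtr_sqr lecR distrC leNgt tt.
Qed.

(** The remainder is a real polynomial of degree at most 1 with a nonreal root, hence 0. *)
Lemma nonreal_root_dvd (F : {poly R}) (z : C) : root (map_poly rc F) z ->
  complex.Im z != 0 ->
  ('X - (complex.Re z)%:P) ^+ 2 + (complex.Im z ^+ 2)%:P %| F.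
Proof.
case: z => a b /=; set z := (a +i* b)%C => Fz b0; set q := _ + _.
have lt : (size ((b ^+ 2)%:P : {poly R})%R < size (('X - a%:P) ^+ 2 : {poly R})%R)%N.
  by rewrite (leq_ltn_trans (size_polyC_leq1 _))// size_exp_XsubC.
have qs : size q = 3 by rewrite size_polyDl// size_exp_XsubC.
have q0 : q != 0 by rewrite -size_poly_eq0 qs.
have qz : (map_poly rc q).[z] = 0.
  rewrite /q rmorphD rmorphXn rmorphB/= map_polyX !map_polyC/= hornerD horner_exp.
  rewrite hornerXsubC hornerC; apply/eqP; rewrite eq_complex/=; apply/andP; split; apply/eqP; ring.
set r := F %% q; have rs : (size r <= 2)%N by have := ltn_modp F q; rewrite q0 qs.
have rz : (map_poly rc r).[z] = 0.
  move: Fz; rewrite /root {1}(divp_eq F q) rmorphD rmorphM hornerD hornerM qz mulr0 add0r.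
  by move=> /eqP.
rewrite /dvdp -/r; move: rz.
rewrite (@horner_coef_wide _ 2) ?size_map_poly// !big_ord_recl big_ord0/= !coef_map/=.
rewrite expr0 mulr1 expr1 addr0 => /eqP; rewrite eq_complex/= !mul0r !(subr0, addr0, add0r).
rewrite mulf_eq0 (negbTE b0) orbF => /andP[r0 r1].
have {}r1 : r`_1 = 0 by exact/eqP.
have {}r0 : r`_0 = 0 by move: r0; rewrite /bump/= ?addn0 r1 mul0r addr0 => /eqP.
rewrite -size_poly_eq0 -leqn0; apply/leq_sizeP => -[|[|j]] _ //.
by rewrite nth_default// (leq_trans rs).
Qed.

Lemma real_roots_dvd (F : {poly R}) (a b : R) : root F a -> root F b -> a != b ->
  ('X - a%:P) * ('X - b%:P) %| F.
Proof.
move=> Fa Fb ab; rewrite Gauss_dvdp; first by rewrite !dvdp_XsubCl Fa.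
by rewrite coprimep_XsubC2// subr_eq0 eq_sym.
Qed.

Lemma compact_dist (K : set R) (z : C) : compact K ->
  ~ (complex.Im z = 0 /\ K (complex.Re z)) ->
  exists2 d, 0 < d & forall y, K y -> rc d <= `|rc y - z|.
Proof.
case: z => a b cK /= nK; have clK : closed K by exact: compact_closed cK.
have nE y : `|rc y - (a +i* b)%C| = rc (Num.sqrt ((y - a) ^+ 2 + b ^+ 2)).
  by rewrite normc_def/= add0r sqrrN.
have [b0|b0] := eqVneq b 0.
  have nKa : (~` K) a by move=> Ka; apply: nK.
  have /nbhs_ballP[d /= d0 Hd] : nbhs a (~` K) by apply: open_nbhs_nbhs; split => //; exact: closed_openC.
  exists d => // y Ky; rewrite nE lecR b0 expr0n addr0 sqrtr_sqr leNgt; apply/negP => yd.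
  by apply: (Hd y) => //; rewrite /ball/= distrC.
exists `|b|; first by rewrite normr_gt0.
move=> y Ky; rewrite nE lecR -(sqrtr_sqr b); apply: ler_wsqrtr; by rewrite lerDr sqr_ge0.
Qed.

Section extremal.
Variables (K : set R) (f : {poly R}) (m : nat).
Hypotheses (cK : compact K) (npK : nonpolar K).
Hypotheses (fm : f \is monic) (fs : size f = m.+1) (m0 : (0 < m)%N).
Let M := 2 * Cap K ^+ m.
Hypothesis fM : forall x, K x -> `|f.[x]| <= M.

(* [cheb_double f M k] is again extremal, so the dual functional of its degree charges only
   points where it is +-max; dividing out a quadratic positive on [K] would keep the signs
   but lower the degree. *)
Lemma extremal_no_quadratic (k : nat) (q : {poly R}) : size q = 3 ->
  (forall y, K y -> 0 < q.[y]) -> ~ (q %| cheb_double f M k).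
Proof.
move=> qs q0 qF; set F := cheb_double f M k in qF.
have [Fm Fs] := cheb_double_monic M k fm fs m0.
pose D := (m * 2 ^ k)%N; rewrite -/F in Fm Fs.
have D0 : (0 < D)%N by rewrite muln_gt0 m0 expn_gt0.
have C0 := Cap_gt0 cK npK.
have [x0 [x0I Kx0]] := nonpolar_points cK npK D.
have [x [w [T [g [T0 Kx w0 w1 [lam gm gs gT]]]]]] := chebyshev_duality cK x0I Kx0.
(* T bounds the monic [g] of degree D on K, so it is at least 2 Cap(K)^D, which is exactly the bound
   known for [F]. *)
have MT : 2 * (M / 2) ^+ (2 ^ k) <= T.
  have -> : M / 2 = Cap K ^+ m by rewrite /M mulrC mulKf.
  by rewrite -exprM; apply: (Cap_le_half cK npK gm gs D0).
have Fle i : w i * F.[x i] <= `|w i| * T.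
  rewrite (le_trans (ler_norm _))// normrM ler_wpM2l// (le_trans _ MT)//.
  by apply: cheb_double_le; apply: fM; exact: Kx.
have FT : \sum_i w i * F.[x i] = T.
  by rewrite lam ?Fs//; have /eqP := Fm; rewrite /lead_coef Fs /= => ->; rewrite mulr1.
have Feq i : w i * F.[x i] = `|w i| * T.
  have : \sum_i (`|w i| * T - w i * F.[x i]) = 0.
    by rewrite sumrB -mulr_suml w1 mul1r FT subrr.
  move/eqP; rewrite psumr_eq0; last by move=> j _; rewrite subr_ge0.
  by move=> /allP/(_ i); rewrite mem_index_enum subr_eq0 => /(_ isT)/eqP.
pose h := F %/ q; have Fh : F = h * q by rewrite divpK.
have hs : (size h <= D)%N.
  by rewrite size_divp ?Fs ?qs/= ?subn2/= ?leq_pred// -size_poly_eq0 qs.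
have := lam h (leqW hs); rewrite nth_default// mulr0 => /eqP.
have hpos i : 0 < w i * h.[x i].
  have qi := q0 _ (Kx i); rewrite -(pmulr_lgt0 _ qi) -mulrA -hornerM -Fh Feq.
  by rewrite mulr_gt0// normr_gt0.
rewrite psumr_eq0 => [/allP/(_ ord0)|i _]; last exact: ltW.
by rewrite mem_index_enum => /(_ isT); rewrite gt_eqF.
Qed.

(** A point z of the preimage outside K has a distance d > 0 from K, and some iterate has two roots
    within d of z. A nonreal root, or two real roots with no point of K between them, yields a
    forbidden quadratic factor. *)
Lemma extremal_preimage : poly_preimage_interval K m.
Proof.
have C0 := Cap_gt0 cK npK; have M0 : 0 < M by rewrite mulr_gt0 ?exprn_gt0.
pose fC := map_poly rc f.
have fCs : size fC = m.+1 by rewrite size_map_poly.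
exists ((rc M^-1) *: fC); split.
  by rewrite size_scale// eq_complex/= negb_and invr_eq0 gt_eqF.
move=> z; rewrite hornerZ.
have -> : (complex.Im (rc M^-1 * fC.[z]) = 0 /\ -1 <= complex.Re (rc M^-1 * fC.[z]) <= 1) <->
    exists2 t, fC.[z] = rc t & -M <= t <= M.
  case: fC.[z] => u v /=; rewrite !mul0r subr0 addr0; split.
    move=> [/eqP]; rewrite mulf_eq0 invr_eq0 (gt_eqF M0)/= => /eqP -> /andP[h1 h2].
    exists u => //; move: h1 h2; rewrite [M^-1 * u]mulrC ler_pdivlMr// ler_pdivrMr//.
    by rewrite mulN1r mul1r => -> ->.
  move=> [t [-> ->] /andP[h1 h2]]; rewrite mulr0; split=> //.
  by rewrite mulrC ler_pdivlMr// mulN1r h1/= ler_pdivrMr// mul1r.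
split; last first.
  case: z => a b /= [-> Ka]; exists f.[a]; first by rewrite -horner_map.
  by rewrite -ler_norml; exact: fM.
move=> [t fz tM]; apply: contrapT => nK.
have [d d0 dK] := compact_dist cK nK.
have dm : 0 < d ^+ m by rewrite exprn_gt0.
have [k [t1 [t2 [t12 t1t t2t ct1 ct2]]]] := cheb_nodes_dense M0 tM dm.
have [z1 fz1 z1d] := root_near fm fs m0 fz d0 t1t.
have [z2 fz2 z2d] := root_near fm fs m0 fz d0 t2t.
have r1 := cheb_double_rootC fz1 ct1; have r2 := cheb_double_rootC fz2 ct2.
have z12 : z1 != z2.
  by apply: contraNneq t12 => z12; move: fz1; rewrite z12 fz2 => /complexI ->.
have nonreal u : root (map_poly rc (cheb_double f M k)) u -> complex.Im u = 0.
  move=> ru; apply/eqP; apply: contraT => u0.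
  have := nonreal_root_dvd ru u0; apply: contraPT => _.
  apply: extremal_no_quadratic.
    rewrite size_polyDl size_exp_XsubC// (leq_ltn_trans (size_polyC_leq1 _))//.
  move=> y _; rewrite hornerD horner_exp hornerXsubC hornerC ltr_wpDl ?sqr_ge0//.
  by rewrite exprn_even_gt0.
case: z1 z2 z1d z2d r1 r2 z12 {fz1 fz2} => [a1 b1] [a2 b2] z1d z2d r1 r2.
have /= b10 := nonreal _ r1; have /= b20 := nonreal _ r2; rewrite b10 b20 in z1d z2d r1 r2 *.
rewrite eq_complex/= eqxx andbT => a12.
have R1 : root (cheb_double f M k) a1.
  by move: r1; rewrite /root -[(a1 +i* 0)%C]/(rc a1) horner_map => /eqP/complexI ->.
have R2 : root (cheb_double f M k) a2.
  by move: r2; rewrite /root -[(a2 +i* 0)%C]/(rc a2) horner_map => /eqP/complexI ->.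
apply: (extremal_no_quadratic _ _ (real_roots_dvd R1 R2 a12)).
  by rewrite size_Mmonic ?monicXsubC ?polyXsubC_eq0// !size_XsubC.
(* If (y - a1) (y - a2) <= 0 then y lies between the roots, hence by convexity in the open disc of
   radius d about z, which contains no point of K. *)
move=> y Ky; rewrite hornerM !hornerXsubC ltNge; apply/negP => yq.
have := dK y Ky; case: (z) z1d z2d => a b.
rewrite !normc_def/= !add0r !sqrrN !ltcR lecR => z1d z2d.
rewrite leNgt => /negP; apply.
have : Num.sqrt ((y - a) ^+ 2 + b ^+ 2) <= Num.max (Num.sqrt ((a1 - a) ^+ 2 + b ^+ 2))
    (Num.sqrt ((a2 - a) ^+ 2 + b ^+ 2)).
  rewrite le_max; apply/orP.
  have [H|H] := lerP ((y - a) ^+ 2) ((a1 - a) ^+ 2).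
    by left; apply: ler_wsqrtr; rewrite lerD2r.
  right; apply: ler_wsqrtr; rewrite lerD2r.
  have [ya|ya] := lerP a y.
    have p1 : a1 < y by rewrite ltNge; apply/negP => ?; move: H; rewrite ltNge => /negP; apply; nra.
    have p2 : y <= a2 by rewrite leNgt; apply/negP => ?; move: yq; rewrite leNgt => /negP; apply; nra.
    nra.
  have p1 : y < a1 by rewrite ltNge; apply/negP => ?; move: H; rewrite ltNge => /negP; apply; nra.
  have p2 : a2 <= y by rewrite leNgt; apply/negP => ?; move: yq; rewrite leNgt => /negP; apply; nra.
  nra.
by move=> /le_lt_trans; apply; rewrite gt_max z1d.
Qed.

End extremal.

End preimage.

(** * Product sets *)

Section one_dim.
Context {R : realType}.
Local Notation rc := (real_complex R).

(** Nodes and weights become sequences, with zero weights beyond m, so that coordinates of different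
    degrees can share one index range in the tensor product. *)
Lemma dual_functional (K : set R) (m : nat) : compact K -> nonpolar K ->
  exists (x w : nat -> R) (T : R) (f : {poly R}),
  [/\ 0 < T, forall k, K (x k),
      forall N, (m < N)%N -> \sum_(k < N) `|w k| = 1 /\
        forall p, (p <= m)%N -> \sum_(k < N) w k * x k ^+ p = T * (p == m)%:R,
      f \is monic /\ size f = m.+1 & forall y, K y -> `|f.[y]| <= T].
Proof.
move=> cK npK; have [x0 [x0I Kx0]] := nonpolar_points cK npK m.
have [x [w [T [f [T0 Kx w0 w1 [lam fm fs fT]]]]]] := chebyshev_duality cK x0I Kx0.
exists (fun k => x (inord k)), (fun k => if (k < m.+1)%N then w (inord k) else 0), T, f.
split=> // N mN.
have W (F : nat -> R -> R) : (forall k, F k 0 = 0) ->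
    \sum_(k < N) F k (if (k < m.+1)%N then w (inord k) else 0) = \sum_(k < m.+1) F k (w k).
  move=> F0; transitivity (\sum_(k < m.+1) F k (w (inord k))); last first.
    by apply: eq_bigr => k _; rewrite inord_val.
  rewrite [RHS](big_ord_widen N (fun k => F k (w (inord k)))) ?leqW//.
  by rewrite [RHS]big_mkcond/=; apply: eq_bigr => k _; case: ifP.
split; first by rewrite (W (fun _ => Num.norm)) ?normr0.
move=> p pm; rewrite (W (fun k y => y * x (inord k) ^+ p)) => [|k]; last by rewrite mul0r.
have := lam 'X^p; rewrite size_polyXn ltnS pm coefXn eq_sym => /(_ isT) <-.
by apply: eq_bigr => k _; rewrite inord_val hornerXn.
Qed.

(** Divided by its leading coefficient, p is at most 1 / |lead p| <= 2 Cap(K)^m on K. Taking real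
    parts of the coefficients keeps it monic and does not increase its absolute value at real
    points. *)
Lemma monic_of_preimage (K : set R) (m : nat) : compact K -> nonpolar K -> (0 < m)%N ->
  poly_preimage_interval K m -> exists f : {poly R}, [/\ f \is monic, size f = m.+1 &
    forall x, K x -> `|f.[x]| <= 2 * Cap K ^+ m].
Proof.
move=> cK npK m0 [p [ps pK]].
have C1 := preimage_Cap cK npK ps (fun z => (pK z).1) m0.
set A := ComplexField.Normc.normc _ in C1.
have ln0 : lead_coef p != 0 by rewrite lead_coef_eq0 -size_poly_eq0 ps.
have A0 : 0 < A by rewrite -ltcR -[A%:C%C]/(`|lead_coef p|) normr_gt0.
pose q := (lead_coef p)^-1 *: p.
have qm : q`_m = 1 by rewrite coefZ -[m]/(m.+1.-1) -ps mulVf.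
pose f := \poly_(i < m.+1) complex.Re q`_i.
have fmE : f`_m = 1 by rewrite coef_poly ltnSn qm.
have fs : size f = m.+1.
  apply/eqP; rewrite eqn_leq size_poly ltnNge; apply/negP => /leq_sizeP/(_ m (leqnn _)).
  by rewrite fmE => /eqP; rewrite oner_eq0.
exists f; split=> //; first by rewrite monicE /lead_coef fs fmE.
move=> x Kx.
have fx : f.[x] = complex.Re q.[rc x].
  rewrite horner_poly (@horner_coef_wide _ m.+1) ?(leq_trans (size_scale_leq _ _)) ?ps//.
  rewrite (big_morph (fun z : R[i] => complex.Re z) (id1 := 0) (op1 := +%R)) => [||//].
    by apply: eq_bigr => i _; rewrite -rmorphXn; case: q`_i => u v /=; rewrite mulr0 subr0.
  by case=> u v; case.
have [|p1 p2] := (pK (rc x)).2; first by [].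
apply: (@le_trans _ _ A^-1); last by rewrite -(ler_pM2l A0) mulfV ?gt_eqF//; lra.
rewrite fx hornerZ -lecR; apply: le_trans (normc_ge_Re _) _.
rewrite normrM normfV rmorphV ?unitfE ?gt_eqF//= -[A%:C%C]/(`|lead_coef p|).
rewrite -[leRHS]mulr1 ler_wpM2l ?invr_ge0//.
case: (p.[_]) p1 p2 => u v /= -> uv; rewrite normc_def/= expr0n addr0 sqrtr_sqr.
by rewrite (_ : 1 = 1%:C%C)// lecR ler_norml.
Qed.

End one_dim.

(** * The graded lexicographic enumeration *)

Section grlex.
Variables (n : nat) (e : nat -> 'I_n -> nat).
Hypothesis eP : monomial_enum e.

(** If a <= b in every coordinate, |b| < |a| is impossible, and the strict inequality at [l] in the
    lexicographic case would make |a| < |b|. *)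
Lemma grlex_prec_lt (a b : 'I_n -> nat) : grlex_prec b a -> exists j, (b j < a j)%N.
Proof.
move=> H; apply: contrapT => nH.
have ab j : (a j <= b j)%N by rewrite leqNgt; apply/negP => ?; apply: nH; exists j.
case: H => [|[ba [l [al _]]]]; first by rewrite ltnNge /mdeg leq_sum.
have : (mdeg a < mdeg b)%N.
  by rewrite /mdeg (bigD1 l)//= [X in (_ < X)%N](bigD1 l)//= -addSn leq_add// leq_sum.
by rewrite ba ltnn.
Qed.

Lemma enum_lt_ex (l i : nat) : (l < i)%N -> exists j, (e l j < e i j)%N.
Proof. by move=> /(eP.2)/grlex_prec_lt. Qed.

Lemma enum_inj : injective e.
Proof.
move=> l i li; case: (ltngtP l i) => // /enum_lt_ex[j]; by rewrite li ltnn.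
Qed.

(** The divisors of e_i are enumerated no later than e_i, so a product of one-variable monic
    polynomials of degrees [e i j] belongs to the class of e_i. *)
Lemma enum_le (l i : nat) : (forall j, (e l j <= e i j)%N) -> (l <= i)%N.
Proof.
move=> H; rewrite leqNgt; apply/negP => /enum_lt_ex[j]; by rewrite ltnNge H.
Qed.

Lemma mdeg_homo (l i : nat) : (l <= i)%N -> (mdeg (e l) <= mdeg (e i))%N.
Proof.
rewrite leq_eqVlt => /orP[/eqP -> //|/(eP.2)[/ltnW//|[-> _]//]].
Qed.

Lemma mdeg_gt0 (i : nat) : (0 < i)%N -> (0 < mdeg (e i))%N.
Proof.
move=> /enum_lt_ex[j]; rewrite /mdeg (bigD1 j)//= => H.
by rewrite addn_gt0 (leq_ltn_trans _ H).
Qed.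

End grlex.

(** * Sup norms *)

Section supnorm.
Context {R : realType}.
Local Notation rc := (real_complex R).
Local Notation normc := ComplexField.Normc.normc.
Variables (n : nat) (K : set ('I_n -> R)).
Hypothesis K0 : K !=set0.

Lemma normrE_normc (z : R[i]) : `|z| = rc (normc z). Proof. by []. Qed.

Lemma normc_rc (r : R) : normc (rc r) = `|r|.
Proof. by rewrite /normc/= expr0n/= addr0 sqrtr_sqr. Qed.

Lemma supnorm_le f B : (forall x, K x -> normc (f x) <= B) -> supnorm K f <= B.
Proof.
move=> fB; apply: ge_sup; first by have [x Kx] := K0; exists (normc (f x)); exists x.
by move=> _ [x Kx <-]; exact: fB.
Qed.

(** The bound makes [sup], which takes a default value on unbounded sets, a true supremum. *)
Lemma supnorm_ge f B x : (forall x, K x -> normc (f x) <= B) -> K x ->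
  normc (f x) <= supnorm K f.
Proof.
move=> fB Kx; apply: ub_le_sup; last by exists x.
by exists B => _ [y Ky <-]; exact: fB.
Qed.

End supnorm.

(** * Tensor products of functionals and of polynomials *)

Section product.
Context {R : realType}.
Local Notation rc := (real_complex R).
Local Notation normc := ComplexField.Normc.normc.
Variables (n : nat) (Kj : 'I_n -> set R) (e : nat -> 'I_n -> nat).
Hypotheses (eP : monomial_enum e) (cK : forall j, compact (Kj j)).
Hypothesis npK : forall j, nonpolar (Kj j).
Local Notation K := (prodset Kj).

Lemma prodset_neq0 : K !=set0.
Proof.
have H j : exists x, Kj j x.
  by have [x [_ Kx]] := nonpolar_points (@cK j) (npK j) 0; exists (x ord0).
by exists (fun j => projT1 (cid (H j))) => j; exact: (projT2 (cid (H j))).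
Qed.

Lemma Pval_bounded i c : exists B, forall x, K x -> normc (Pval e i c x) <= B.
Proof.
have H j : exists b : R, forall x, Kj j x -> `|x| <= expR b.
  by have [_ [b _ [Kb _]]] := compact_realP (@cK j); exists b.
pose b j := projT1 (cid (H j)).
have bP j x : Kj j x -> `|x| <= expR (b j) by exact: (projT2 (cid (H j))).
have mB a x : K x -> `|monom a x| <= rc (\prod_j expR (b j) ^+ a j).
  move=> Kx; rewrite /monom normr_prod rmorph_prod; apply: ler_prod => j _.
  have xj : `|rc (x j)| <= rc (expR (b j)) by rewrite normrE_normc normc_rc lecR bP.
  have e0 := le_trans (normr_ge0 _) xj.
  by rewrite normr_ge0 normrX rmorphXn/=; apply: lerXn2r; rewrite ?nnegrE.
exists (\prod_j expR (b j) ^+ e i j + \sum_(l < i) normc (c l) * \prod_j expR (b j) ^+ e l j).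
move=> x Kx; rewrite -lecR -normrE_normc rmorphD (le_trans (ler_normD _ _))//.
apply: lerD; first exact: mB.
rewrite rmorph_sum (le_trans (ler_norm_sum _ _ _))//; apply: ler_sum => l _.
by rewrite normrM rmorphM ler_wpM2l// mB.
Qed.

Lemma supnorm_ge0 i c : 0 <= supnorm K (Pval e i c).
Proof.
have [B PB] := Pval_bounded i c; have [x Kx] := prodset_neq0.
by apply: le_trans (supnorm_ge PB Kx); rewrite -ler0c -normrE_normc.
Qed.

Lemma tcheb_le i c : tcheb e K i <= supnorm K (Pval e i c).
Proof.
apply: ge_inf; last by exists c.
by exists 0 => _ [d _ <-]; exact: supnorm_ge0.
Qed.

Lemma tcheb_ge i B : (forall c, B <= supnorm K (Pval e i c)) -> B <= tcheb e K i.
Proof.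
move=> H; apply: lb_le_inf; first by exists (supnorm K (Pval e i (fun=> 0))); exists (fun=> 0).
by move=> _ [c _ <-].
Qed.

(* The product of one-dimensional dual functionals kills every monomial preceding [e i]:
   such a monomial has some exponent smaller than that of [e i]. *)
Lemma tcheb_ge_prod (i : nat) (x w : 'I_n -> nat -> R) (T : 'I_n -> R) :
  (forall j k, Kj j (x j k)) ->
  (forall j N, (e i j < N)%N -> \sum_(k < N) `|w j k| = 1 /\
     forall p, (p <= e i j)%N -> \sum_(k < N) w j k * x j k ^+ p = T j * (p == e i j)%:R) ->
  (forall j, 0 < T j) ->
  \prod_j T j <= tcheb e K i.
Proof.
move=> Kx wP T0; apply: tcheb_ge => c.
pose N := (\max_j e i j).+1.
have iN j : (e i j < N)%N by rewrite ltnS (leq_bigmax j).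
pose xf (phi : {ffun 'I_n -> 'I_N}) j := x j (phi j).
pose wf (phi : {ffun 'I_n -> 'I_N}) := \prod_j w j (phi j).
have Kxf phi : K (xf phi) by move=> j; exact: Kx.
(* On a monomial the tensor functional is the product of the one-variable functionals. *)
have mon a : \sum_phi rc (wf phi) * monom a (xf phi) =
    rc (\prod_j \sum_(k < N) w j k * x j k ^+ a j).
  rewrite bigA_distr_bigA rmorph_sum; apply: eq_bigr => phi _.
  rewrite /wf /monom rmorph_prod -big_split rmorph_prod; apply: eq_bigr => j _.
  by rewrite rmorphM rmorphXn.
have lam : \sum_phi rc (wf phi) * Pval e i c (xf phi) = rc (\prod_j T j).
  transitivity (\sum_phi (rc (wf phi) * monom (e i) (xf phi) +
      \sum_(l < i) rc (wf phi) * (c l * monom (e l) (xf phi)))).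
    by apply: eq_bigr => phi _; rewrite /Pval mulrDr mulr_sumr.
  rewrite big_split/= exchange_big/= [X in _ + X]big1 ?addr0 => [|l _].
    rewrite mon; congr rc; apply: eq_bigr => j _.
    by rewrite (wP j N (iN j)).2// eqxx mulr1.
  under eq_bigr do rewrite mulrCA; rewrite -mulr_sumr mon.
  have [j lj] := enum_lt_ex eP (ltn_ord l).
  by rewrite (bigD1 j)//= (wP j N (iN j)).2 1?ltnW// ltn_eqF// mulr0 mul0r rmorph0 mulr0.
have w1 : \sum_(phi : {ffun 'I_n -> 'I_N}) `|wf phi| = 1.
  under eq_bigr do rewrite normr_prod.
  rewrite -(bigA_distr_bigA (fun j (k : 'I_N) => `|w j k|)); apply: big1 => j _.
  exact: (wP j N (iN j)).1.
have [B PB] := Pval_bounded i c.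
rewrite -[leRHS]mul1r -[X in _ <= X * _]w1 mulr_suml -lecR.
apply: (@le_trans _ _ `|rc (\prod_j T j)|).
  by rewrite normrE_normc normc_rc lecR ler_norm.
rewrite -lam rmorph_sum (le_trans (ler_norm_sum _ _ _))//; apply: ler_sum => phi _.
rewrite normrM normrE_normc normc_rc rmorphM ler_wpM2l ?ler0c// normrE_normc lecR.
exact: supnorm_ge PB (Kxf phi).
Qed.

(** The product of the f_j(x_j) is a competitor. Its expansion runs over exponents in a box, the
    competitor over indices up to i; terms not dividing e_i vanish on both sides, and the rest
    correspond through the enumeration. *)
Lemma tcheb_le_prod (i : nat) (f : 'I_n -> {poly R}) (B : 'I_n -> R) :
  (forall j, f j \is monic) -> (forall j, size (f j) = (e i j).+1) ->
  (forall j y, Kj j y -> `|(f j).[y]| <= B j) ->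
  tcheb e K i <= \prod_j B j.
Proof.
move=> fm fs fB.
pose c l := rc (\prod_j (f j)`_(e l j)).
apply: le_trans (tcheb_le i c) _; apply: supnorm_le; first exact: prodset_neq0.
move=> x Kx.
suff -> : Pval e i c x = rc (\prod_j (f j).[x j]).
  rewrite normc_rc normr_prod; apply: ler_prod => j _.
  by rewrite normr_ge0 fB.
have fe j : (f j)`_(e i j) = 1 by have /eqP := fm j; rewrite /lead_coef fs.
pose G (a : 'I_n -> nat) := \prod_j ((f j)`_(a j) * x j ^+ a j).
have -> : Pval e i c x = rc (\sum_(l < i.+1) G (e l)).
  rewrite big_ord_recr/= addrC rmorphD rmorph_sum; congr (_ + _).
    rewrite /G /monom rmorph_prod; apply: eq_bigr => j _.
    by rewrite fe mul1r rmorphXn.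
  apply: eq_bigr => l _; rewrite /c /monom /G big_split/= rmorphM; congr (_ * _).
  by rewrite rmorph_prod; apply: eq_bigr => j _; rewrite rmorphXn.
congr rc.
pose N := (\max_j e i j).+1.
have iN j : (e i j < N)%N by rewrite ltnS (leq_bigmax j).
have -> : \prod_j (f j).[x j] = \sum_(phi : {ffun 'I_n -> 'I_N}) G (fun j => phi j).
  rewrite -(bigA_distr_bigA (fun j (k : 'I_N) => (f j)`_k * x j ^+ k)).
  by apply: eq_bigr => j _; rewrite (@horner_coef_wide _ N) ?fs.
pose le_i (a : 'I_n -> nat) := [forall j, (a j <= e i j)%N].
have G0 a : ~~ le_i a -> G a = 0.
  move=> /forallPn[j]; rewrite -ltnNge => ij.
  by rewrite /G (bigD1 j)//= nth_default ?fs// mul0r mul0r.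
rewrite (bigID (fun phi : {ffun 'I_n -> 'I_N} => le_i (fun j => phi j)))/=.
rewrite [X in _ = _ + X]big1 ?addr0; last by move=> phi /G0.
rewrite (bigID (fun l : 'I_i.+1 => le_i (e l)))/=.
rewrite [X in _ + X = _]big1 ?addr0; last by move=> l /G0.
pose idx (a : 'I_n -> nat) := projT1 (cid (eP.1 a)).
have idxP a : e (idx a) = a by exact: (projT2 (cid (eP.1 a))).
pose h (phi : {ffun 'I_n -> 'I_N}) : 'I_i.+1 := inord (idx (fun j => phi j)).
pose h' (l : 'I_i.+1) : {ffun 'I_n -> 'I_N} := [ffun j => inord (e l j)].
have eh (phi : {ffun 'I_n -> 'I_N}) : le_i (fun j => phi j) -> e (h phi) = (fun j => phi j).
  move=> /forallP le; rewrite /h inordK ?idxP// ltnS.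
  by apply: (enum_le eP) => j; rewrite idxP.
have h'E (l : 'I_i.+1) j : le_i (e l) -> h' l j = e l j :> nat.
  by move=> /forallP le; rewrite ffunE inordK// (leq_ltn_trans (le j)).
have key phi : le_i (e (h phi)) && (h' (h phi) == phi) = le_i (fun j => phi j).
  apply/andP/idP => [[le /eqP H]|le].
    by apply/forallP => j; rewrite -H h'E//; move/forallP: le.
  rewrite eh//; split=> //; apply/eqP/ffunP => j; apply: val_inj.
  by rewrite /= h'E eh.
rewrite (reindex_onto h h')/=.
  by apply: eq_big => [phi|phi]; rewrite key// => le; rewrite eh.
move=> l le; apply: val_inj => /=; rewrite inordK.
  by apply: (enum_inj eP); rewrite idxP; apply/funext => j; rewrite h'E.
by rewrite ltnS; apply: (enum_le eP) => j; rewrite idxP h'E//; move/forallP: le.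
Qed.

End product.

(** * Lower limits of bounded real sequences *)

Section liminf_real.
Context {R : realType}.
Variables (u : R^nat) (l B : R).
Hypothesis uB : forall i, 0 <= u i <= B.

Let bounded_u : bounded_fun u.
Proof.
exists B; split; first exact: num_real.
move=> M BM i _ /=; have /andP[u0 ui] := uB i.
by rewrite ger0_norm// (le_trans ui)// ltW.
Qed.

Let infs_le n i : (n <= i)%N -> infs u n <= u i.
Proof.
move=> ni; apply: ge_inf; last by exists i.
by exists 0 => _ [k _ <-]; have /andP[] := uB k.
Qed.

Lemma limn_inf_le : (forall (e : R) (n : nat), 0 < e -> exists2 i, (n <= i)%N & u i <= l + e) ->
  limn_inf u <= l.
Proof.
move=> H; rewrite limn_infE//; apply: ge_sup; first by exists (infs u 0%N); exists 0%N.
move=> _ [n _ <-]; apply/ler_addgt0Pr => e e0; have [i ni ui] := H e n e0.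
exact: le_trans (infs_le ni) ui.
Qed.

Lemma limn_inf_ge (n : nat) : (forall i, (n <= i)%N -> l <= u i) -> l <= limn_inf u.
Proof.
move=> H; rewrite limn_infE//; apply: (@le_trans _ _ (infs u n)).
  apply: lb_le_inf; first by exists (u n); exists n => /=.
  by move=> _ [k /= nk <-]; exact: H.
apply: ub_le_sup; last by exists n.
exists B => _ [k _ <-]; apply: le_trans (infs_le (leqnn k)) _.
by have /andP[] := uB k.
Qed.

End liminf_real.

(** * Capacity bounds on product sets *)

Section main.
Context {R : realType}.
Variables (n : nat) (Kj : 'I_n -> set R) (e : nat -> 'I_n -> nat).
Hypotheses (eP : monomial_enum e) (cK : forall j, compact (Kj j)).
Hypothesis npK : forall j, nonpolar (Kj j).
Local Notation K := (prodset Kj).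
Let B i j := 2 ^+ cind (e i j) * Cap (Kj j) ^+ e i j.

Let B0 i j : 0 < B i j.
Proof. by rewrite mulr_gt0 ?exprn_gt0// (Cap_gt0 (@cK j) (npK j)). Qed.

(** The same T_j enter the lower bound and are attained as bounds of monic f_j, so equality in the
    theorem makes each f_j extremal. For exponent 0, f_j = 1 and no factor 2 appears. *)
Lemma tcheb_dual i : exists (T : 'I_n -> R) (f : 'I_n -> {poly R}),
  [/\ \prod_j T j <= tcheb e K i, forall j, B i j <= T j,
      forall j, f j \is monic, forall j, size (f j) = (e i j).+1 &
      forall j y, Kj j y -> `|(f j).[y]| <= T j].
Proof.
have [x D1] := choice (fun j => dual_functional (e i j) (@cK j) (npK j)).
have [w D2] := choice D1; have [T D3] := choice D2; have [f D] := choice D3.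
have fm j : f j \is monic by have [_ _ _ []] := D j.
have fs j : size (f j) = (e i j).+1 by have [_ _ _ []] := D j.
have fT j y : Kj j y -> `|(f j).[y]| <= T j by have [_ _ _ _ H] := D j; exact: H.
have T0 j : 0 < T j by have [] := D j.
exists T, f; split=> //.
  have Kx j k : Kj j (x j k) by have [_ H _ _ _] := D j; exact: H.
  have wP j N : (e i j < N)%N -> \sum_(k < N) `|w j k| = 1 /\
      forall p, (p <= e i j)%N -> \sum_(k < N) w j k * x j k ^+ p = T j * (p == e i j)%:R.
    by have [_ _ H _ _] := D j; exact: H.
  exact: (tcheb_ge_prod eP (@cK) Kx wP T0).
move=> j; rewrite /B /cind; have [ej0|ej0] := posnP (e i j).
  have [x0 [_ Kx0]] := nonpolar_points (@cK j) (npK j) 0.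
  have := fT j _ (Kx0 ord0); have f1 : f j = 1.
    have := fs j; rewrite ej0 => /eqP/size_poly1P[a _ fa].
    by have := fm j; rewrite fa monicE lead_coefC => /eqP ->.
  by rewrite f1 hornerC normr1 ej0 !expr0 mulr1.
by rewrite expr1; apply: (Cap_le_half (@cK j) (npK j) (fm j) (fs j) ej0); exact: fT.
Qed.

Lemma tcheb_lower i : \prod_j B i j <= tcheb e K i.
Proof.
have [T [f [TK BT _ _ _]]] := tcheb_dual i.
apply: le_trans TK; apply: ler_prod => j _; by rewrite BT ltW.
Qed.

Lemma tcheb_eqP i : tcheb e K i = \prod_j B i j <->
  forall j, e i j = 0%N \/ poly_preimage_interval (Kj j) (e i j).
Proof.
split=> [tB j|H].
  have [T [f [TK BT fm fs fT]]] := tcheb_dual i.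
  have [ej0|ej0] := posnP (e i j); [by left|right].
  suff TB : T j <= B i j.
    apply: (extremal_preimage (@cK j) (npK j) (fm j) (fs j) ej0) => y Ky.
    by apply: le_trans (fT j y Ky) (le_trans TB _); rewrite /B /cind ej0 expr1.
  (* The product of the T_l is at most that of the B_l, while B_l <= T_l for every l; bounding the
     other factors from below isolates T_j <= B_j. *)
  have P0 : 0 < \prod_(l | l != j) B i l by apply: prodr_gt0.
  rewrite -(ler_pM2r P0); move: TK; rewrite tB (bigD1 j)//= [X in _ <= X](bigD1 j)//=.
  apply: le_trans; rewrite ler_wpM2l//; first by rewrite (le_trans _ (BT j))// ltW.
  by apply: ler_prod => l _; rewrite BT ltW.
have F j : exists f : {poly R}, [/\ f \is monic, size f = (e i j).+1 &
    forall y, Kj j y -> `|f.[y]| <= B i j].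
  have [ej0|ej0] := posnP (e i j).
    exists 1; rewrite monic1 size_poly1 ej0; split=> // y _.
    by rewrite hornerC normr1 /B ej0 mulr1.
  have [ej|Hp] := H j; first by rewrite ej in ej0.
  have [f [fm fs fC]] := monic_of_preimage (@cK j) (npK j) ej0 Hp.
  by exists f; split=> // y /fC; rewrite /B /cind ej0 expr1.
pose f j := projT1 (cid (F j)).
have fP j : [/\ f j \is monic, size (f j) = (e i j).+1 &
    forall y, Kj j y -> `|(f j).[y]| <= B i j] by exact: (projT2 (cid (F j))).
apply/eqP; rewrite eq_le tcheb_lower andbT.
apply: (tcheb_le_prod eP (@cK) npK (f := f)) => j.
- by have [] := fP j.
- by have [] := fP j.
- by have [_ _] := fP j.
Qed.

Lemma Wcheb_ge2 i : (1 <= i)%N -> 2 <= Wcheb e K i.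
Proof.
move=> i0; have [j1 _] := enum_lt_ex eP i0.
(* The coordinate [j1] shows that there is at least one capacity to minimise over. *)
have C0 j := Cap_gt0 (@cK j) (npK j).
have [j0 _ Cmin] := @arg_minP _ _ _ j1 predT (fun j => Cap (Kj j)) isT.
pose c := Cap (Kj j0); have c0 : 0 < c by exact: C0.
have low k : (0 < k)%N -> 2 * c ^+ mdeg (e k) <= tcheb e K k.
  move=> k0; apply: le_trans (tcheb_lower k).
  rewrite /B big_split/=; apply: ler_pM; rewrite ?exprn_ge0 ?(ltW c0)//.
    have [j ej] : exists j, (0 < e k j)%N.
      by have [j H] := enum_lt_ex eP k0; exists j; apply: leq_ltn_trans H.
    rewrite (bigD1 j)//= {1}/cind ej expr1 ler_peMr//.
    apply: (big_ind (fun z : R => 1 <= z)) => // [a b|l _]; first exact: mulr_ege1.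
    by rewrite exprn_ege1// ler1n.
  rewrite /mdeg -prodrXr; apply: ler_prod => j _.
  rewrite exprn_ge0 ?(ltW c0)//=; apply: lerXn2r; rewrite ?nnegrE ?(ltW c0) ?(ltW (C0 j))//.
  exact: Cmin.
have tc0 k : 0 <= tcheb e K k.
  by apply: le_trans (tcheb_lower k); apply: prodr_ge0 => j _; exact: ltW.
pose u k := powR (tcheb e K k) (mdeg (e k))%:R^-1.
have u_le k a : (0 < k)%N -> 0 <= a -> tcheb e K k <= a ^+ mdeg (e k) -> u k <= a.
  move=> k0 a0 ta; have m0 := mdeg_gt0 eP k0.
  have -> : a = powR (a ^+ mdeg (e k)) (mdeg (e k))%:R^-1.
    by rewrite -powR_mulrn// -powRrM mulfV ?powRr1// pnatr_eq0 -lt0n.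
  by apply: ge0_ler_powR; rewrite ?invr_ge0// nnegrE// exprn_ge0.
have u_ge k a : (0 < k)%N -> 0 <= a -> a ^+ mdeg (e k) <= tcheb e K k -> a <= u k.
  move=> k0 a0 ta; have m0 := mdeg_gt0 eP k0.
  have -> : a = powR (a ^+ mdeg (e k)) (mdeg (e k))%:R^-1.
    by rewrite -powR_mulrn// -powRrM mulfV ?powRr1// pnatr_eq0 -lt0n.
  by apply: ge0_ler_powR; rewrite ?invr_ge0// nnegrE// exprn_ge0.
have [M uM] : exists M, forall k, 0 <= u k <= M.
  have H j : exists b : R, 0 <= b /\ forall x, Kj j x -> `|x| <= expR b.
    by have [_ [b b0 [Kb _]]] := compact_realP (@cK j); exists b.
  pose b j := projT1 (cid (H j)).
  have bP j : 0 <= b j /\ forall x, Kj j x -> `|x| <= expR (b j) by exact: (projT2 (cid (H j))).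
  pose M := \prod_j expR (b j).
  have bM j : expR (b j) <= M.
    rewrite /M (bigD1 j)//= ler_peMr ?expR_ge0// -expR_sum -expR0 ler_expR.
    by apply: sumr_ge0 => l _; have [] := bP l.
  have M1 : 1 <= M by rewrite /M -expR_sum -expR0 ler_expR; apply: sumr_ge0 => l _; have [] := bP l.
  (* At k = 0 the degree is 0 and the exponent is the default value of 0^-1, so this term is simply
     added to the bound. *)
  exists (M + u 0%N) => k; rewrite powR_ge0/=.
  have [->|k0] := posnP k; first by rewrite lerDr; apply: le_trans M1.
  apply: (@le_trans _ _ M); last by rewrite lerDl powR_ge0.
  apply: u_le => //; first exact: le_trans M1.
  apply: le_trans (tcheb_le_prod eP (@cK) npK (f := fun j => 'X^(e k j))
     (B := fun j => M ^+ e k j) _ _ _) _.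
  - by move=> j; exact: monicXn.
  - by move=> j; rewrite size_polyXn.
  - move=> j y Ky; rewrite hornerXn normrX; apply: lerXn2r; rewrite ?nnegrE ?(le_trans ler01 M1)//.
    by apply: le_trans (bM j); have [_] := bP j; exact.
  - by rewrite /mdeg -prodrXr.
have tau_ge : c <= tau_minus e K.
  apply: (limn_inf_ge (n := 1) uM) => k k0; apply: u_ge => //; first exact: ltW.
  by apply: le_trans (low k k0); rewrite ler_peMl ?exprn_ge0 ?(ltW c0)//; lra.
have tau_le : tau_minus e K <= c.
  apply: (limn_inf_le uM) => d N d0.
  have cd : Cap (Kj j0) < c + d by rewrite ltrDl.
  have [D [g [D0 gm gs gc]]] := fekete_szego (@cK j0) (npK j0) cd.
  (* The pure power of degree D q in the coordinate [j0] has degree above |alpha(N)|, hence an index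
     beyond N; [g ^+ q] bounds its Chebyshev constant. *)
  pose q := (mdeg (e N)).+1.
  pose a (j : 'I_n) := if j == j0 then (D * q)%N else 0%N.
  have [k ek] := eP.1 a.
  have mk : mdeg (e k) = (D * q)%N.
    rewrite ek /mdeg /a (bigD1 j0)//= eqxx big1 ?addn0// => j /negbTE ->//.
  have kN : (N < k)%N.
    rewrite ltnNge; apply/negP => /(mdeg_homo eP); rewrite mk leqNgt => /negP; apply.
    by rewrite (@leq_trans q)// leq_pmull.
  exists k; first exact: ltnW.
  have cd0 : 0 <= c + d by rewrite addr_ge0 ?ltW.
  apply: u_le => //; first exact: leq_ltn_trans kN.
  apply: le_trans (tcheb_le_prod eP (@cK) npK (f := fun j => if j == j0 then g ^+ q else 1)
     (B := fun j => if j == j0 then (c + d) ^+ (D * q) else 1) _ _ _) _.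
  - by move=> j; case: ifP; rewrite ?monic1 ?monic_exp.
  - move=> j; rewrite ek /a; case: ifP => _; last by rewrite size_poly1.
    have := size_exp g q; rewrite gs/=; have : size (g ^+ q) != 0%N.
      by rewrite size_poly_eq0 monic_neq0// monic_exp.
    by rewrite -lt0n => s0 H; rewrite -(prednK s0) H.
  - move=> j y; case: eqP => [->|_ _]; last by rewrite hornerC normr1.
    move=> Ky; rewrite horner_exp normrX exprM lerXn2r ?nnegrE ?exprn_ge0//.
    exact/ltW/gc.
  - by rewrite (bigD1 j0)//= eqxx big1 ?mulr1 ?mk// => j /negbTE ->.
rewrite /Wcheb; have tau0 : 0 < tau_minus e K by exact: lt_le_trans tau_ge.
rewrite ler_pdivlMr ?exprn_gt0//; apply: le_trans (low i i0).
by rewrite ler_pM2l// lerXn2r ?nnegrE// ltW.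
Qed.

End main.

Theorem theorem4p6 (R : realType) (n : nat) (Kj : 'I_n -> set R)
  (e : nat -> 'I_n -> nat) :
  monomial_enum e ->
  (forall j, compact (Kj j)) ->
  (forall j, nonpolar (Kj j)) ->
  (forall i : nat,
     (\prod_(j < n) 2 ^+ cind (e i j)) * (\prod_(j < n) Cap (Kj j) ^+ e i j)
       <= tcheb e (prodset Kj) i) /\
  (forall i : nat, (1 <= i)%N -> 2 <= Wcheb e (prodset Kj) i) /\
  (forall i : nat,
     tcheb e (prodset Kj) i
       = (\prod_(j < n) 2 ^+ cind (e i j)) * (\prod_(j < n) Cap (Kj j) ^+ e i j)
     <-> (forall j : 'I_n, e i j = 0%N \/ poly_preimage_interval (Kj j) (e i j))).
Proof.
move=> eP cK npK; split=> [i|]; first by rewrite -big_split; exact: tcheb_lower.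
split=> i; first exact: Wcheb_ge2.
by rewrite -big_split; exact: tcheb_eqP.
Qed.
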